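(* Let $T$ be a finite abelian group and $T^\circ:=T\setminus\{e_T\}$. For $y\in T$ and $k\in\mathbb{N}$, as $n\to\infty$, $$\mathrm{E}[J_{n+1}^{\,k}(y,(n+1))]=\sum_{\sigma\in\overline{\mathbb{Y}}_k}\Bigl\{\sum_{(n^x_1,n^x_2,\dots)_{x\in T^\circ}:\,(\star)_y}|\mathrm{NC}(\sigma)|\,n^{k-l(\sigma)}\bigl(1+O(n^{-1})\bigr)|T|^{k-l(\sigma)}\binom{m_1(\sigma^\times)}{(n^x_1)_{x\in T}}\binom{m_2(\sigma^\times)}{(n^x_2)_{x\in T}}\cdots\frac{A_{\iota_{n,|\sigma^\times|}((1^{n^x_1}2^{n^x_2}\cdots))_{x\in T}}}{\bigl|C_{\iota_{n,|\sigma^\times|}((1^{n^x_1}2^{n^x_2}\cdots))_{x\in T}}\bigr|}+\sum_{g\in N_\sigma}g\Bigr\}.$$ Here the condition $(\star)_y$ on the family of integers $(n^x_1,n^x_2,\dots)_{x\in T^\circ}$ is: $$n^x_i\in\{0,1,\dots,m_i(\sigma^\times)\},\quad \sum_{x\in T^\circ}n^x_i\le m_i(\sigma^\times)\ \ (i=1,2,\dots),\quad\text{and}\quad\prod_{x\in T^\circ}x^{n^x_1+n^x_2+\cdots}=y,$$ and one sets $n^{e_T}_i:=m_i(\sigma^\times)-\sum_{x\in T^\circ}n^x_i$. The extra terms $N_\sigma$ (a finite family, i.e. multiset, of elements of $\mathfrak{S}_n(T)$, depending on $n$, $k$, $y$, $\sigma$) consist of elements of $\mathfrak{S}_n(T)$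 whose types have as nontrivial cycles (cycles other than $(e_T,1)$-cycles) $\sigma^\times$, possibly with some $1$-box rows missing; that is, the multiset of lengths of the nontrivial cycles of each $g\in N_\sigma$ is obtained from the rows of $\sigma^\times$ by deleting some (possibly no) rows of length $1$. Moreover $$|N_\sigma|=O(n^{k-l(\sigma)-1})\qquad(n\to\infty).$$
   Context: $\mathfrak{S}_n(T)=T^n\rtimes\mathfrak{S}_n$ is the wreath product ($\mathfrak{S}_n$ permutes coordinates), with $\mathfrak{S}_n(T)\subset\mathfrak{S}_{n+1}(T)$ via $T^n\cong T^n\times\{e_T\}$. For $t\in T$, $(t,(i))$ is the element of $T^{n+1}$ with $i$th entry $t$ and other entries $e_T$. The Jucys–Murphy element is $J_{n+1}=\sum_{i=1}^n\sum_{x\in T}(x^{-1},(i))(x,(n+1))(i\ \ n+1)\in\mathbb{C}[\mathfrak{S}_{n+1}(T)]$. The linear map $\mathrm{E}:\mathbb{C}[\mathfrak{S}_{n+1}(T)]\to\mathbb{C}[\mathfrak{S}_n(T)]$ satisfies $\mathrm{E}[g]=g$ for $g\in\mathfrak{S}_n(T)$ and $\mathrm{E}[g]=0$ for $g\in\mathfrak{S}_{n+1}(T)\setminus\mathfrak{S}_n(T)$. Types: an element of $\mathfrak{S}_n(T)$ decomposes into disjoint cycles $(i_1\ i_2\cdots i_p)$ of $\mathfrak{S}_n$ (fixed points included, as cycles of length $1$), each carrying the entries $t_{i_1},\dots,t_{i_p}\in T$ supported on it; such a cycle is called an $(x,p)$-cycle if $t_{i_p}\cdots t_{i_1}=x$.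 Since $T$ is abelian, conjugacy classes of $\mathfrak{S}_n(T)$ are parametrized by $\mathbb{Y}_n(T)=\{(\rho_x)_{x\in T}:\rho_x\in\mathbb{Y},\ \sum_x|\rho_x|=n\}$: the class $C_\rho$ consists of the elements (of type $\rho$) having, for every $x$ and $p$, exactly $m_p(\rho_x)$ $(x,p)$-cycles. $A_\rho=\sum_{g\in C_\rho}g$. For $k\le n$, $\iota_{n,k}:\mathbb{Y}_k(T)\to\mathbb{Y}_n(T)$ adds $n-k$ rows of length $1$ to the $e_T$-entry and leaves the other entries unchanged. $\mathbb{Y}$ is the set of Young diagrams; $|\sigma|$, $l(\sigma)$, $m_j(\sigma)$ denote the number of boxes, the number of rows, and the number of rows of length $j$; $(1^{a_1}2^{a_2}\cdots)$ is the diagram with $a_j$ rows of length $j$. $\overline{\mathbb{Y}}_k=\{\sigma\in\mathbb{Y}:|\sigma|=k,\ m_1(\sigma)=0\}$. For $\sigma\in\overline{\mathbb{Y}}_k$, $\sigma^\times$ is obtained by removing the first column of $\sigma$, i.e. $m_{j-1}(\sigma^\times)=m_j(\sigma)$ for $j\ge2$. $\mathrm{NC}(\sigma)$ is the set of non-crossing partitions of $\{1,\dots,k\}$ whose block sizes are the row lengths of $\sigma$. Multinomial coefficient: $\binom{m}{(n^\alpha)_{\alpha\in A}}=m!/\prod_{\alpha\in A}n^\alpha!$ where $\sum_\alpha n^\alpha=m$. The range $(\star)_y$ is finite and independent of $n$; each factor $1+O(n^{-1})$ is a scalar which may depend on $\sigma$ and $(n^x_i)$. *)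

(* Defs.v *)
From HB Require Import structures.
From mathcomp Require Import all_boot all_order all_algebra all_fingroup.
From mathcomp Require Import complex.
From mathcomp Require Import all_classical all_reals all_analysis.

Set Implicit Arguments.
Unset Strict Implicit.
Unset Printing Implicit Defensive.

Import Order.TTheory GRing.Theory Num.Theory.

Local Open Scope ring_scope.

Record wreath (T : finGroupType) (n : nat) :=
  Wreath { wbase : {ffun 'I_n -> T}; wperm : 'S_n }.

Section WreathGroup.
Variables (T : finGroupType) (n : nat).
Implicit Types g h : wreath T n.

Definition wreath_pair g := (wbase g, wperm g).
Definition pair_wreath (p : {ffun 'I_n -> T} * 'S_n) : wreath T n :=
  Wreath p.1 p.2.

Lemma wreath_pairK : cancel wreath_pair pair_wreath.
Proof. by case. Qed.

HB.instance Definition _ := Finite.copy (wreath T n) (can_type wreath_pairK).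

(* (t, s)(t', s') = (t . s(t'), s s') with (s(t'))_i = t'_(s^-1 i) and s s' the
   composite "s' first"; mathcomp permutations compose the other way round,
   whence wperm h * wperm g. *)
Definition wreath_mul g h : wreath T n :=
  Wreath [ffun i => (wbase g i * wbase h ((wperm g)^-1 i))%g]
         (wperm h * wperm g)%g.

Definition wreath_one : wreath T n := Wreath [ffun=> 1%g] 1%g.

Definition wreath_inv g : wreath T n :=
  Wreath [ffun i => ((wbase g (wperm g i))^-1)%g] (wperm g)^-1%g.

Lemma wreath_mulA : associative wreath_mul.
Proof.
move=> [t s] [u v] [w z]; congr Wreath; rewrite /= ?mulgA //.
by apply/ffunP=> i; rewrite !ffunE /= mulgA invMg permM.
Qed.

Lemma wreath_mul1 : left_id wreath_one wreath_mul.
Proof.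
move=> [t s]; congr Wreath; rewrite /= ?mulg1 //.
by apply/ffunP=> i; rewrite !ffunE /= mul1g invg1 perm1.
Qed.

Lemma wreath_mulV : left_inverse wreath_one wreath_inv wreath_mul.
Proof.
move=> [t s]; congr Wreath; rewrite /= ?mulgV //.
by apply/ffunP=> i; rewrite !ffunE /= invgK mulVg.
Qed.

HB.instance Definition _ :=
  Finite_isGroup.Build (wreath T n) wreath_mulA wreath_mul1 wreath_mulV.

(* (t, (i)) *)
Definition wat (t : T) (i : 'I_n) : wreath T n :=
  Wreath [ffun j => if j == i then t else 1%g] 1%g.

Definition wtperm (i j : 'I_n) : wreath T n := Wreath [ffun=> 1%g] (tperm i j).

End WreathGroup.

(* The inclusion of S_n(T) in S_(n+1)(T): the coordinate n+1 is ord_max. *)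
Definition wincl (T : finGroupType) (n : nat) (g : wreath T n) :
    wreath T n.+1 :=
  Wreath [ffun i => if unlift ord_max i is Some j then wbase g j else 1%g]
         (lift_perm ord_max ord_max (wperm g)).

Lemma wincl_inj (T : finGroupType) (n : nat) : injective (@wincl T n).
Proof.
move=> [t s] [t' s'] [/ffunP eqt /permP eqs]; congr Wreath.
  by apply/ffunP=> i; have := eqt (lift ord_max i); rewrite !ffunE liftK.
apply/permP=> i; have := eqs (lift ord_max i); rewrite !lift_perm_lift.
exact: lift_inj.
Qed.

Lemma winclM (T : finGroupType) (n : nat) :
  {morph @wincl T n : g h / (g * h)%g}.
Proof.
move=> [t s] [t' s']; congr Wreath; last by rewrite /= lift_permM.
apply/ffunP=> i; rewrite !ffunE /= lift_permV.
case: (unliftP ord_max i) => [j|] ->.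
  by rewrite lift_perm_lift liftK ffunE.
by rewrite lift_perm_id unlift_none mulg1.
Qed.

(* A finite group ring as functions on the group; the product is convolution
   (the alias hides the pointwise product of finite functions). *)
Definition galg (K : nzRingType) (gT : finGroupType) : Type :=
  {ffun gT -> K^o}.

Section GroupAlgebra.
Variables (K : nzRingType) (gT : finGroupType).

HB.instance Definition _ := GRing.Lmodule.copy (galg K gT) {ffun gT -> K^o}.

Implicit Types a b c : galg K gT.

Definition gelt (g : gT) : galg K gT := [ffun h => (h == g)%:R].

Definition gmul a b : galg K gT :=
  [ffun g => \sum_(h : gT) (a h : K) * (b (h^-1 * g)%g : K)].

Lemma gmulA : associative gmul.
Proof.
move=> a b c; apply/ffunP=> g; rewrite !ffunE.
under eq_bigr => h _ do rewrite ffunE big_distrr.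
under [RHS]eq_bigr => h _ do rewrite ffunE big_distrl.
rewrite [RHS]exchange_big /=; apply: eq_bigr => h _.
rewrite [RHS](reindex_inj (mulgI h)) /=; apply: eq_bigr => u _.
by rewrite mulKg invMg mulgA mulrA.
Qed.

Lemma gmul1l : left_id (gelt 1%g) gmul.
Proof.
move=> a; apply/ffunP=> g; rewrite ffunE (bigD1 1%g) //= big1 => [|h /negPf h1].
  by rewrite ffunE eqxx mul1r invg1 mul1g addr0.
by rewrite ffunE h1 mul0r.
Qed.

Lemma gmul1r : right_id (gelt 1%g) gmul.
Proof.
move=> a; apply/ffunP=> g; rewrite ffunE (bigD1 g) //= big1 => [|h /negPf hg].
  by rewrite ffunE mulVg eqxx mulr1 addr0.
by rewrite ffunE -eq_mulVg1 hg mulr0.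
Qed.

Lemma gmulDl : left_distributive gmul +%R.
Proof.
move=> a b c; apply/ffunP=> g; rewrite !ffunE -big_split /=.
by apply: eq_bigr => h _; rewrite ffunE mulrDl.
Qed.

Lemma gmulDr : right_distributive gmul +%R.
Proof.
move=> a b c; apply/ffunP=> g; rewrite !ffunE -big_split /=.
by apply: eq_bigr => h _; rewrite ffunE mulrDr.
Qed.

Lemma gelt1_neq0 : gelt 1%g != 0.
Proof.
by apply/eqP=> /ffunP/(_ 1%g)/eqP; rewrite !ffunE eqxx oner_eq0.
Qed.

HB.instance Definition _ := GRing.Zmodule_isNzRing.Build (galg K gT)
  gmulA gmul1l gmul1r gmulDl gmulDr gelt1_neq0.

Lemma geltM (g h : gT) : gelt (g * h)%g = gelt g * gelt h.
Proof.
apply/ffunP=> u; rewrite [RHS]ffunE (bigD1 g) //= big1 => [|v /negPf vg].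
  rewrite !ffunE eqxx mul1r addr0; congr (_ %:R); congr (nat_of_bool _).
  by rewrite -(inj_eq (mulgI g) (g^-1 * u)%g) mulKVg.
by rewrite ffunE vg mul0r.
Qed.

End GroupAlgebra.

Section JucysMurphy.
Variables (K : nzRingType) (T : finGroupType) (n : nat).

(* The index i <= n is lift ord_max i in 'I_n.+1. *)
Definition jucys_murphy : galg K (wreath T n.+1) :=
  \sum_(i : 'I_n) \sum_(x : T)
    gelt K (wat x^-1 (lift ord_max i) * wat x ord_max
            * wtperm T (lift ord_max i) ord_max)%g.

Definition condexp (a : galg K (wreath T n.+1)) : galg K (wreath T n) :=
  [ffun g => a (wincl g)].

Lemma condexp_linear : linear condexp.
Proof. by move=> u a b; apply/ffunP=> g; rewrite !ffunE. Qed.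

Lemma condexp_wincl (g : wreath T n) : condexp (gelt K (wincl g)) = gelt K g.
Proof. by apply/ffunP=> h; rewrite !ffunE (inj_eq (@wincl_inj T n)). Qed.

Lemma condexp_notin (g : wreath T n.+1) :
  g \notin codom (@wincl T n) -> condexp (gelt K g) = 0.
Proof.
move=> gP; apply/ffunP=> h; rewrite !ffunE; case: eqP => // hg.
by rewrite -hg codom_f in gP.
Qed.

End JucysMurphy.

Record young := Young {
  rows :> seq nat;
  rowsP : sorted geq rows && (0 \notin rows)%N
}.

HB.instance Definition _ := [isSub for rows].
HB.instance Definition _ := [Countable of young by <:].

Section YoungOf.
Variable s : seq nat.

Lemma young_of_subproof :
  sorted geq (sort geq [seq r <- s | 0 < r]%N)
  && (0 \notin sort geq [seq r <- s | 0 < r]%N)%N.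
Proof.
by rewrite sort_sorted => [|m n]; rewrite ?mem_sort ?mem_filter ?leq_total.
Qed.

(* The diagram whose row lengths are the nonzero entries of s. *)
Definition young_of : young := Young young_of_subproof.

End YoungOf.

Definition boxes (s : young) : nat := sumn s.
Definition nrows (s : young) : nat := size s.
Definition nrow (j : nat) (s : young) : nat := count_mem j s.

(* Removal of the first column. *)
Definition strip (s : young) : young := young_of [seq r.-1 | r <- s].

(* (1^(a_0) 2^(a_1) ...): rows of length j.+1 have multiplicity a j. *)
Definition young_mult (k : nat) (a : 'I_k -> nat) : young :=
  young_of (flatten [seq nseq (a j) j.+1 | j <- enum 'I_k]).

Lemma nrow_young_of (j : nat) (s : seq nat) :
  (0 < j)%N -> nrow j (young_of s) = count_mem j s.
Proof.
move=> j0; rewrite /nrow /= count_sort count_filter.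
by apply: eq_count => i /=; case: eqP => // ->; rewrite j0.
Qed.

Lemma nrow_strip (j : nat) (s : young) :
  (0 < j)%N -> nrow j (strip s) = nrow j.+1 s.
Proof.
move=> j0; rewrite nrow_young_of // /nrow count_map; apply: eq_count => -[|i] //=.
by case: j j0.
Qed.

Lemma nrow_young_mult (k : nat) (a : 'I_k -> nat) (j : 'I_k) :
  nrow j.+1 (young_mult a) = a j.
Proof.
rewrite nrow_young_of // count_flatten -map_comp sumnE big_map big_enum /=.
rewrite (bigD1 j) //= count_nseq /= eqxx mul1n big1 ?addn0 // => i /negPf ij.
by rewrite count_nseq /= eqSS -[_ == _]/(i == j) ij.
Qed.

Lemma young_of_rows (s : young) : young_of s = s.
Proof.
apply: val_inj => /=; have /andP[s_sorted s0] := rowsP s.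
have -> : [seq r <- s | 0 < r]%N = s.
  by apply/all_filterP/allP => -[|r] //; rewrite (negPf s0).
by apply: sorted_sort => // a b c /= ba ac; exact: leq_trans ac ba.
Qed.

(* Diagrams with k boxes and no row of length 1, without repetition. *)
Definition Ybar (k : nat) : seq young :=
  [seq s <- undup [seq young_of (map val b) | b : k.-bseq 'I_k.+1]
     | (boxes s == k) && (nrow 1 s == 0)%N].

Lemma mem_Ybar (k : nat) (s : young) :
  (s \in Ybar k) = (boxes s == k) && (nrow 1 s == 0)%N.
Proof.
rewrite mem_filter mem_undup; case: eqP => //= sk.
case: eqP => //= _.
have /andP[_ s0] := rowsP s.
have size_s : (size s <= k)%N.
  rewrite -sk /boxes; elim: (rows s) s0 => //= r u IHu.
  rewrite in_cons negb_or eq_sym -lt0n => /andP[r0 /IHu].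
  by rewrite -(leq_add2l 1) => /leq_trans -> //; rewrite leq_add2r.
have row_s r : r \in rows s -> (r < k.+1)%N.
  by move=> rs; rewrite ltnS -sk /boxes sumnE (big_rem r) //= leq_addr.
have valK : map val (map (@inord k) s) = s.
  by rewrite -map_comp map_id_in // => r rs /=; rewrite inordK ?row_s.
have size_b : (size (map (@inord k) s) <= k)%N by rewrite size_map.
apply/mapP; exists (Bseq size_b); first by rewrite mem_enum.
by rewrite /= valK young_of_rows.
Qed.

(* Non-crossing partitions of {1, ..., k} = 'I_k with block sizes the rows of
   s. *)
Definition noncrossing (k : nat) (P : {set {set 'I_k}}) : bool :=
  [forall A in P, forall B in P, (A != B) ==>
    ~~ [exists a in A, exists b in B, exists c in A, exists d in B,
          [&& a < b, b < c & c < d]%N]].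

Definition NC (k : nat) (s : young) : {set {set {set 'I_k}}} :=
  [set P | [&& finset.partition P [set: 'I_k], noncrossing P &
               perm_eq [seq #|B| | B : {set 'I_k} in P] s]].

Section Types.
Variable T : finGroupType.

Definition tsize (rho : {ffun T -> young}) : nat :=
  (\sum_(x : T) boxes (rho x))%N.

(* iota_(n, k), rho being of size k *)
Definition tiota (n k : nat) (rho : {ffun T -> young}) : {ffun T -> young} :=
  [ffun x => if x == 1%g then young_of (rho x ++ nseq (n - k) 1%N) else rho x].

Lemma tsize_tiota (n k : nat) (rho : {ffun T -> young}) :
  tsize rho = k -> (k <= n)%N -> tsize (tiota n k rho) = n.
Proof.
move=> rhok kn; rewrite /tsize (bigD1 1%g) //= ffunE eqxx.
under eq_bigr => x /negPf x1 do rewrite ffunE x1.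
have -> : boxes (young_of (rho 1%g ++ nseq (n - k) 1%N))
          = (boxes (rho 1%g) + (n - k))%N.
  rewrite /boxes /= (perm_sumn (permEl (perm_sort _ _))) filter_cat sumn_cat.
  rewrite filter_nseq sumn_nseq mul1n !mul1n; congr (_ + _)%N.
  by elim: (rows (rho 1%g)) => //= -[|r] u IHu //=; rewrite IHu.
move: rhok; rewrite /tsize (bigD1 1%g) //= => rhok.
by rewrite addnAC rhok subnKC.
Qed.

Variable n : nat.
Implicit Types g : wreath T n.

(* A cycle of g is an orbit C of its permutation (fixed points included); it is
   an (x, p)-cycle when C has p points and the entries of g over C have product
   x. As T is meant to be abelian, the order of the factors is irrelevant. *)
Definition is_xpcycle g (x : T) (p : nat) (C : {set 'I_n}) : bool :=
  [&& C \in porbits (wperm g), #|C| == p & (\prod_(i in C) wbase g i)%g == x].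

Definition nxpcycle g (x : T) (p : nat) : nat :=
  #|[set C | is_xpcycle g x p C]|.

(* For rho of size n only the lengths p <= n matter. *)
Definition tclass (rho : {ffun T -> young}) : {set wreath T n} :=
  [set g | [forall x : T, forall p : 'I_n.+1, nxpcycle g x p == nrow p (rho x)]].

Lemma tclassP (rho : {ffun T -> young}) g : tsize rho = n ->
  reflect (forall x p, nxpcycle g x p = nrow p (rho x)) (g \in tclass rho).
Proof.
move=> rhon; rewrite inE; apply: (iffP forallP) => [eq_g x p|eq_g x]; last first.
  by apply/forallP=> p; apply/eqP.
have [ltpn|ltnp] := ltnP p n.+1.
  by have /forallP/(_ (Ordinal ltpn))/eqP := eq_g x.
rewrite /nxpcycle /nrow eq_card0 => [|C]; last first.
  rewrite inE; apply/negP => /and3P[_ /eqP Op _].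
  by have := max_card (mem C); rewrite Op card_ord leqNgt ltnp.
apply/esym/count_memPn; apply/negP => pr.
suff : (p <= n)%N by rewrite leqNgt ltnp.
rewrite -rhon /tsize (bigD1 x) //= (leq_trans _ (leq_addr _ _)) //.
by rewrite /boxes sumnE (big_rem p) //= leq_addr.
Qed.

Definition class_sum (K : nzRingType) (rho : {ffun T -> young}) :
    galg K (wreath T n) :=
  \sum_(g in tclass rho) gelt K g.

(* The lengths of the cycles of g other than its (e_T, 1)-cycles. *)
Definition nontriv_lengths g : seq nat :=
  [seq #|C| | C : {set 'I_n}
     in [set C in porbits (wperm g) | ~~ is_xpcycle g 1%g 1 C]].

(* The nontrivial cycles of g are s, possibly with some 1-box rows missing. *)
Definition nontriv_type (s : young) g : Prop :=
  exists d : nat, perm_eq (nontriv_lengths g ++ nseq d 1%N) s.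

End Types.

Section Families.
Variables (T : finGroupType) (k : nat).

Definition circ : finType := {x : T | x != 1%g}.

(* The entry at (x, j) is n^x_(j.+1). For a diagram s with k boxes, m_i(s) <= k
   and m_i(s) = 0 for i > k, so the ranges of j and of the entries are no
   restriction. *)
Definition nfamily : finType := {ffun circ * 'I_k -> 'I_k.+1}.

Definition star_cond (y : T) (s : young) (f : nfamily) : bool :=
  [&& [forall j, forall x, f (x, j) <= nrow j.+1 (strip s)],
      [forall j : 'I_k, \sum_(x : circ) f (x, j) <= nrow j.+1 (strip s)]
    & (\prod_(x : circ) val x ^+ (\sum_(j < k) f (x, j)))%g == y]%N.

(* n^x_(j.+1) for all x in T, the entry at e_T being the complement *)
Definition fam_ext (s : young) (f : nfamily) (x : T) (j : 'I_k) : nat :=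
  if insub x is Some x' then f (x', j)
  else (nrow j.+1 (strip s) - \sum_(x' : circ) f (x', j))%N.

Definition fam_type (s : young) (f : nfamily) : {ffun T -> young} :=
  [ffun x => young_mult (fam_ext s f x)].

End Families.

Definition multinomial (K : fieldType) (A : finType) (m : nat) (a : A -> nat) :
    K :=
  m`!%:R / \prod_(x : A) (a x)`!%:R.

(* Main.v *)
From HB Require Import structures.
Require Import Defs.
From mathcomp Require Import all_boot all_order all_algebra all_fingroup.
From mathcomp Require Import zify.

(** Expanding the [k]-th power of the Jucys-Murphy element gives one group
    element for each pair of a word [w] of [k] letters in {1, ..., n} and a
    sequence [x] of [k] labels in [T].  Its permutation is the product [pi] of
    the transpositions (w_p n+1); call n+1 the star.  Let d be the number of
    distinct letters of [w] and c the number of cycles of [pi] consisting of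
    letters.  Only words for which [pi] fixes the star contribute.

    Genus.  A transposition joins two cycles or splits one, and a letter that
    has not been used before always joins.  Hence k = d + c + 2g, where g >= 0
    counts the joins caused by old letters ([genus_word]).  Let the shape of
    [w] be the diagram with a row of length |C| + 1 for each letter cycle C and
    g more rows of length 2 ([wshape]).  It has k boxes, no row of length 1,
    and k - l(s) = d + g.  So a word of shape s has k - l(s) letters if g = 0
    and fewer letters otherwise.  There are O(n^D) words with D letters, and
    thus the words with g > 0 make up the remainder N_s ([size_remainder]);
    the cycle lengths are right by construction ([nontriv_type_wshape]).

    Words of genus 0.  Put two positions in the same block if their letters
    are in the same cycle of [pi].  The first and the last letter of a block
    occur twice ([first_repeats], [last_repeats]), so that the block of C has
    more than |C| positions.  As k = d + c, it has exactly |C| + 1: its ends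
    carry the same letter, and there is no other coincidence
    ([planar_extreme_kernel]).  Following the point that sits at the star from
    one position to the next shows that the blocks do not cross
    ([planar_crossing_free]).  Conversely, if the letters coincide exactly at
    the ends of the blocks of a noncrossing partition, then the blocks are the
    cycles and the genus is 0 ([cyc_kappaE], [kernel_planar]).  Consequently
    there are |NC(s)| n (n-1) ... (n - (k - l(s)) + 1) words of genus 0 and
    shape s ([card_planar_words]); the falling factorial is
    n^(k - l(s)) (1 + O(1/n)).

    Labels.  For a fixed word, the charges of the letter cycles are a
    homomorphism from T^k to T^c, and it is onto because the label at the
    first position of a cycle acts only on this cycle and on one that starts
    earlier.  So every family of charges comes from |T|^(k - c) sequences of
    labels ([card_charges]), and the entry at the star is trivial exactly when
    the charges have product [y] ([prod_charge]).  The families with a given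
    number of cycles of each length and charge are counted by multinomial
    coefficients ([card_colourings]).

    Conjugation.  Elements of the same type are conjugate ([wreath_conj]), and
    conjugation permutes the words ([wincl_jmword]).  So the words of genus 0
    with given shape and charges are spread evenly over one conjugacy class
    ([nwords_coloured]), which gives the class averages. *)

Set Implicit Arguments.
Unset Strict Implicit.
Unset Printing Implicit Defensive.

(** * Products of star transpositions *)

Section StarPerm.
Variables (X : finType) (star : X).
Implicit Types (l : seq X) (a x : X).

(** The letters act as functions, the last one first. *)
Definition starperm l : {perm X} := foldr (fun a s => s * tperm a star)%g 1%g l.

Lemma starperm_rcons l a : starperm (rcons l a) = (tperm a star * starperm l)%g.
Proof. by elim: l => /= [|b l ->]; rewrite ?mul1g ?mulg1 ?mulgA. Qed.

Lemma starperm_out l x : x != star -> x \notin l -> starperm l x = x.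
Proof.
move=> xs; elim: l => /= [|b l IHl]; first by rewrite perm1.
rewrite inE negb_or => /andP[xb /IHl]; rewrite permM => ->.
by rewrite tpermD // eq_sym.
Qed.

Lemma porbit1 (s : {perm X}) x : s x = x -> porbit s x = [set x].
Proof.
move=> sx; apply/setP=> z; rewrite inE; apply/porbitP/eqP => [[i ->]|->].
  by elim: i => [|i IHi]; rewrite ?expg0 ?perm1 // expgSr permM IHi.
by exists 0; rewrite expg0 perm1.
Qed.

(** A letter multiplies by a transposition, which joins the cycle of the letter
    to that of [star] or splits the latter.  A new letter is fixed by the
    product of the others, so it joins; [g] counts the joins due to old
    letters. *)
Lemma porbits_starperm l : star \notin l ->
  exists g, #|porbits (starperm l)| + (size (undup l) + g).*2 = #|X| + size l.
Proof.
elim/last_ind: l => [|l a IHl].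
  exists 0; rewrite addn0 /= !addn0 /porbits card_imset // => x y.
  by rewrite !porbit1 ?perm1 // => /set1_inj.
rewrite mem_rcons inE negb_or => /andP[sa /IHl[g eg]].
have := porbits_mul_tperm (starperm l) a star; rewrite /= -starperm_rcons.
rewrite eq_sym sa addn1 => ep.
have -> : size (undup (rcons l a)) = size (undup (a :: l)).
  by apply: perm_size; apply: perm_undup => z; rewrite mem_rcons.
rewrite /= size_rcons; case: ifP => al.
  exists (g + (a \notin porbit (starperm l) star)).
  move: ep eg; case: (_ \notin _) => /=;
    move: #|porbits _| #|porbits _| #|X| (size _) (size _) => *; lia.
exists g; have na : a \notin porbit (starperm l) star.
  by rewrite porbit_sym porbit1 ?inE // starperm_out ?al // eq_sym.
rewrite na in ep; move: ep eg => /=.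
by move: #|porbits _| #|porbits _| #|X| (size _) (size _) => *; lia.
Qed.

End StarPerm.

(** * Tracing a point through a word *)

Section Words.
Variables (X : finType) (star : X) (k : nat) (w : 'I_k -> X).
Hypothesis w_star : forall p, w p != star.

(** As the last letter acts first, [part q] is what still happens to a point
    when the positions from [q] on have been passed. *)
Definition part q : {perm X} := starperm star (take q (codom w)).

(** The final place of the point that sits at [star] just to the left of
    position [q]. *)
Definition track q : X := part q star.

Lemma take_codomS (p : 'I_k) : take p.+1 (codom w) = rcons (take p (codom w)) (w p).
Proof.
rewrite (take_nth star) ?size_codom ?card_ord //; congr rcons.
by rewrite /codom /image_mem (nth_map p) ?size_enum_ord // nth_ord_enum.
Qed.

Lemma partS (p : 'I_k) : part p.+1 = (tperm (w p) star * part p)%g.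
Proof. by rewrite /part take_codomS starperm_rcons. Qed.

Lemma part0 : part 0 = 1%g. Proof. by rewrite /part take0. Qed.

Lemma partk : part k = starperm star (codom w).
Proof. by rewrite /part take_oversize // size_codom card_ord. Qed.

Lemma part_fresh q x : q <= k -> x != star ->
  (forall p : 'I_k, p < q -> w p != x) -> part q x = x.
Proof.
move=> + xs; elim: q => [|q IHq] qk fresh; first by rewrite part0 perm1.
rewrite (partS (Ordinal qk)) permM tpermD ?fresh //; last by rewrite eq_sym.
by apply: IHq => [|p pq]; [exact: ltnW|apply: fresh; exact: ltnW].
Qed.

(** A point sitting at a letter waits for the next occurrence of this letter
    to the left, and is then at [star]. *)
Lemma part_last q (p : 'I_k) : p < q <= k ->
  (forall r : 'I_k, p < r < q -> w r != w p) -> part q (w p) = track p.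
Proof.
elim: q => // q IHq /andP[]; rewrite ltnS leq_eqVlt => /orP[/eqP <- _ _|pq qk last].
  by rewrite partS permM tpermL.
rewrite (partS (Ordinal qk)) permM tpermD ?last ?pq ?ltnSn //; last by rewrite eq_sym.
apply: IHq => [|r /andP[pr rq]]; first by rewrite pq ltnW.
by apply: last; rewrite pr ltnW.
Qed.

Lemma trackS (p : 'I_k) : track p.+1 = part p (w p).
Proof. by rewrite /track partS permM tpermR. Qed.

Lemma track_fresh (p : 'I_k) : (forall r : 'I_k, r < p -> w r != w p) ->
  track p.+1 = w p.
Proof. by move=> fresh; rewrite trackS part_fresh // ltnW. Qed.

Lemma track_back (p r : 'I_k) : r < p -> w r = w p ->
  (forall t : 'I_k, r < t < p -> w t != w p) -> track p.+1 = track r.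
Proof.
move=> rp wrp last; rewrite trackS -wrp part_last ?rp ?(ltnW (ltn_ord p)) //.
by move=> t tP; rewrite wrp last.
Qed.

Variables (A : eqType) (kappa : 'I_k -> A).

(** Blocks of positions are the classes of a colouring [kappa], so that the
    lemmas apply both to the blocks of a set partition and to the cycles of a
    word. *)
Definition minblk (p : 'I_k) := [arg min_(r < p | kappa r == kappa p) val r].
Definition maxblk (p : 'I_k) := [arg max_(r > p | kappa r == kappa p) val r].

Lemma minblk_kappa p : kappa (minblk p) = kappa p.
Proof. by rewrite /minblk; case: arg_minnP => // r /eqP. Qed.
Lemma maxblk_kappa p : kappa (maxblk p) = kappa p.
Proof. by rewrite /maxblk; case: arg_maxnP => // r /eqP. Qed.
Lemma minblk_le p r : kappa r = kappa p -> minblk p <= r.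
Proof.
by move=> rp; rewrite /minblk; case: arg_minnP => // t _; apply; rewrite rp.
Qed.
Lemma maxblk_ge p r : kappa r = kappa p -> r <= maxblk p.
Proof.
by move=> rp; rewrite /maxblk; case: arg_maxnP => // t _; apply; rewrite rp.
Qed.
Lemma minblk_eq p r : kappa p = kappa r -> minblk p = minblk r.
Proof.
move=> e; apply/val_inj/eqP; rewrite /= eqn_leq.
by rewrite !minblk_le // minblk_kappa.
Qed.
Lemma maxblk_eq p r : kappa p = kappa r -> maxblk p = maxblk r.
Proof.
move=> e; apply/val_inj/eqP; rewrite /= eqn_leq.
by rewrite !maxblk_ge // maxblk_kappa.
Qed.

(** The coincidences between letters in a word of genus 0. *)
Definition extreme_kernel := forall p q : 'I_k, p < q ->
  (w p = w q <-> p = minblk q /\ q = maxblk q).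

Definition crossing_free := forall a b c d : 'I_k, a < b -> b < c -> c < d ->
  kappa a = kappa c -> kappa b = kappa d -> kappa a = kappa b.

Definition no_singleton := forall p, minblk p != maxblk p.

Hypothesis ker_w : extreme_kernel.

Lemma track_nonmax p : p != maxblk p -> track p.+1 = w p.
Proof.
move=> pm; apply: track_fresh => r rp; apply: contra pm => /eqP e.
by have [+ _] := ker_w rp; move/(_ e) => [_ <-].
Qed.

Lemma track_max p : minblk p != p -> p = maxblk p -> track p.+1 = track (minblk p).
Proof.
move=> mp pm; have lt : minblk p < p by rewrite ltn_neqAle mp minblk_le.
apply: track_back => //; first by apply/ker_w.
move=> t /andP[mt tp]; apply: contraTneq mt => e.
by have [+ _] := ker_w tp; move/(_ e) => [-> _]; rewrite ltnn.
Qed.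

(** The last occurrence of a letter is the position itself, unless that is the
    beginning of its block; then it is the end of the block. *)
Lemma final_max (p : 'I_k) : minblk p != maxblk p -> starperm star (codom w) (w p) =
  if p == minblk p then track (maxblk p) else track p.
Proof.
move=> ns; rewrite -partk; case: eqP => [pm|/eqP pm].
  have lt : p < maxblk p by rewrite ltn_neqAle {1}pm ns maxblk_ge.
  have -> : w p = w (maxblk p).
    apply/ker_w => //; split; last by rewrite (maxblk_eq (maxblk_kappa p)).
    by rewrite (minblk_eq (maxblk_kappa p)).
  apply: part_last; rewrite ?ltn_ord ?leqnn // => r /andP[pr _].
  apply/eqP => /esym e; have [+ _] := ker_w pr; move/(_ e) => [mr _].
  have kr : kappa r = kappa p by rewrite -(minblk_kappa r) -mr maxblk_kappa.
  by have := maxblk_ge kr; rewrite leqNgt pr.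
apply: part_last; rewrite ?ltn_ord ?leqnn // => r /andP[pr _].
apply/eqP => /esym e; have [+ _] := ker_w pr; move/(_ e) => [pr' _].
by case/eqP: pm; rewrite {1}pr'; apply: minblk_eq; rewrite pr' minblk_kappa.
Qed.

Hypothesis noncr : crossing_free.
Hypothesis nosing : no_singleton.

Lemma track_maxS q (qk : q < k) : let q' := Ordinal qk in
  (forall r, kappa r = kappa q' -> r <= q) -> minblk q' < q /\ track q.+1 = track (minblk q').
Proof.
move=> q' le; have qm : q' = maxblk q'.
  apply/val_inj/eqP; rewrite /= eqn_leq -[X in X <= _ _]/(val q').
  by rewrite maxblk_ge //= le // maxblk_kappa.
have mq : minblk q' != q' by rewrite {2}qm; apply: nosing.
by split; [rewrite ltn_neqAle mq (@minblk_le q' q')|exact: (track_max mq qm)].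
Qed.

(** A block with a position strictly between the ends of another block is
    enclosed by it, since they would cross otherwise.  This keeps an invariant of the two
    lemmas that follow: the positions already passed form whole blocks. *)
Lemma union_blocks_step (q m : nat) (qk : q < k) (q' := Ordinal qk) :
  q < m ->
  (forall r : 'I_k, q < r < m -> forall s, kappa s = kappa r -> q < s < m) ->
  (forall r, kappa r = kappa q' -> r <= q) ->
  forall r : 'I_k, minblk q' <= r < m -> forall s, kappa s = kappa r -> minblk q' <= s < m.
Proof.
move=> qm inv max_q r /andP[mr rm] s sr.
case: (ltnP q r) => qr.
  have /andP[qs ->] := inv r (introT andP (conj qr rm)) s sr.
  by rewrite andbT; apply: leq_trans (ltnW qs); exact: (@minblk_le q' q').
case: (eqVneq (kappa r) (kappa q')) => [e|ne].
  by rewrite minblk_le ?sr // (leq_ltn_trans (max_q s _)) // sr.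
have rq : r < q.
  rewrite ltn_neqAle qr andbT; apply: contra_neq ne => e.
  by congr kappa; apply: val_inj.
have mr' : minblk q' < r.
  rewrite ltn_neqAle mr andbT; apply: contra_neq ne => e.
  by rewrite -(minblk_kappa q'); congr kappa; apply: val_inj.
have ns : kappa s != kappa q' by rewrite sr.
apply/andP; split.
  rewrite leqNgt; apply/negP => sm; case/eqP: ns.
  apply: etrans (minblk_kappa q'); apply: (noncr sm mr' (d := q')) => //.
  by rewrite minblk_kappa.
apply: leq_ltn_trans qm; rewrite leqNgt; apply/negP => qs; case/eqP: ne.
apply/esym; rewrite -(minblk_kappa q'); apply: (noncr mr' (c := q') (d := s)) => //.
exact: minblk_kappa.
Qed.

(** Going to the left, the point at [star] jumps over whole blocks: the last
    letter of a block takes it away and the first one brings it back. *)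
Lemma track_star q : q <= k ->
  (forall r : 'I_k, q <= r -> forall s, kappa s = kappa r -> q <= s) -> track q = star.
Proof.
elim/ltn_ind: q => -[|q] IHq qk inv; first by rewrite /track part0 perm1.
have max_q r : kappa r = kappa (Ordinal qk) -> r <= q.
  move=> e; rewrite leqNgt; apply/negP => qr.
  by have := inv r qr _ (esym e); rewrite /= ltnn.
have [lt ->] := track_maxS max_q; apply: IHq; [exact: ltnW|exact: ltnW|].
move=> r mr s sr.
have inv' (t : 'I_k) : q < t < k -> forall u, kappa u = kappa t -> q < u < k.
  by move=> /andP[qt _] u ut; rewrite ltn_ord andbT (inv t).
have r2 : minblk (Ordinal qk) <= r < k by rewrite mr ltn_ord.
by have /andP[] := union_blocks_step qk inv' max_q r2 sr.
Qed.

(** The jumps of the point that leaves [p] stop at the preceding position of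
    the block of [p], as a block jumped over would cross this block if it
    contained that position in its interior.  Not being the end of its block,
    that position has a letter that does not occur further left. *)
Lemma track_stays (p : 'I_k) q : q <= p ->
  (exists2 p' : 'I_k, p' < q & kappa p' = kappa p) ->
  (forall r : 'I_k, q <= r < p -> forall s, kappa s = kappa r -> q <= s < p) ->
  exists2 p', track q = w p' & kappa p' = kappa p.
Proof.
elim/ltn_ind: q => -[|q] IHq qp [p' p'q ep'] inv //.
have qk : q < k by apply: ltn_trans (ltn_ord p).
pose q' := Ordinal qk.
case: (eqVneq (kappa q') (kappa p)) => [e|ne].
  exists q' => //; apply: (track_nonmax (p := q')); apply/eqP => qm.
  by have := maxblk_ge (esym e); rewrite -qm leqNgt qp.
have p'q' : p' < q'.
  rewrite ltn_neqAle -ltnS p'q andbT; apply: contra_neq ne => e.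
  by rewrite -ep'; congr kappa; apply: val_inj.
have max_q r : kappa r = kappa q' -> r <= q.
  move=> e; rewrite leqNgt; apply/negP => qr.
  case: (ltngtP r p) => [rp|pr|/val_inj rp]; last by rewrite -e rp eqxx in ne.
    by have := inv r (introT andP (conj qr rp)) _ (esym e); rewrite /= ltnn.
  by case/eqP: ne; rewrite -ep'; apply/esym; apply: (noncr p'q' (c := p) (d := r)).
have [lt ->] := track_maxS max_q.
apply: IHq; first exact: ltnW.
- exact: leq_trans (ltnW lt) (ltnW qp).
- exists p' => //; rewrite ltnNge; apply/negP => mp'.
  have mp : minblk q' < p'.
    rewrite ltn_neqAle mp' andbT; apply: contra_neq ne => e; rewrite -ep' -(minblk_kappa q').
    by congr kappa; apply: val_inj.
  case/eqP: ne; rewrite -ep' -(minblk_kappa q').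
  by apply: (noncr mp (c := q') (d := p)) => //; exact: minblk_kappa.
- by move=> r mr s sr; exact: (union_blocks_step qp inv max_q mr sr).
Qed.

Lemma starperm_star : starperm star (codom w) star = star.
Proof.
rewrite -partk; apply: track_star => // r; rewrite leqNgt => /negP[]; exact: ltn_ord.
Qed.

Lemma starperm_block p :
  exists2 p', starperm star (codom w) (w p) = w p' & kappa p' = kappa p.
Proof.
rewrite final_max //.
have main p1 : minblk p1 != p1 -> exists2 p', track p1 = w p' & kappa p' = kappa p1.
  move=> m1; apply: track_stays => //.
    exists (minblk p1); last exact: minblk_kappa.
    by rewrite ltn_neqAle m1 minblk_le.
  by move=> r /andP[a b]; have := leq_ltn_trans a b; rewrite ltnn.
case: eqP => [pm|/eqP pm]; last by apply: main; rewrite eq_sym.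
rewrite -(maxblk_kappa p); apply: main.
by rewrite (minblk_eq (maxblk_kappa p)).
Qed.

End Words.

(** * Stable blocks do not cross *)

Section Converse.
Variables (X : finType) (star : X) (k : nat) (w : 'I_k -> X).
Hypothesis w_star : forall p, w p != star.
Variables (A : eqType) (kappa : 'I_k -> A).
Hypothesis ker_w : extreme_kernel w kappa.
Hypothesis nosing : no_singleton kappa.
Hypothesis stable : forall p,
  exists2 p', starperm star (codom w) (w p) = w p' & kappa p' = kappa p.

Local Notation minblk := (minblk kappa).
Local Notation maxblk := (maxblk kappa).

Lemma extreme_kernel_block p q : w p = w q -> kappa p = kappa q.
Proof.
have main (r t : 'I_k) : r < t -> w r = w t -> kappa r = kappa t.
  by move=> rt e; have [+ _] := ker_w rt; move=> /(_ e)[-> _]; rewrite minblk_kappa.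
case: (ltngtP p q) => [|qp|/val_inj ->] //; first exact: main.
by move=> /esym e; apply/esym/main.
Qed.

(** The traced point ends in the block of [c], which has no position between
    [e] and [c].  So it cannot stop before it has passed [e], and it passes [e]
    by jumping over some block. *)
Lemma walk (c e p' : 'I_k) q : q <= c -> e < q -> kappa e != kappa c ->
  (forall r : 'I_k, e < r < c -> kappa r != kappa c) ->
  track star w q = w p' -> kappa p' = kappa c ->
  exists b : 'I_k, [/\ b = maxblk b, minblk b <= e, e <= b & b < c].
Proof.
elim/ltn_ind: q => -[|q] IHq qc eq ne gap tr ep' //.
have qk : q < k by apply: leq_trans qc (ltnW (ltn_ord c)).
pose q' := Ordinal qk.
case: (eqVneq q' (maxblk q')) => [qm|qm]; last first.
  have := track_nonmax w_star ker_w qm; rewrite [track _ _ _]tr => /extreme_kernel_block.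
  rewrite ep' => e'; move: eq; rewrite ltnS leq_eqVlt => /orP[/eqP eq|eq].
    by case/eqP: ne; rewrite e'; congr kappa; apply: val_inj.
  by have := gap q'; rewrite -e' eqxx /= eq qc => /(_ isT).
have mq : minblk q' != q' by rewrite {2}qm; apply: nosing.
have trm := track_max w_star ker_w mq qm.
have lt : minblk q' < q by rewrite -[X in _ < X]/(val q') ltn_neqAle mq minblk_le.
case: (leqP (minblk q') e) => me; first by exists q'; split.
apply: (IHq (minblk q')) => //; last by rewrite -trm.
  exact: ltnW.
exact: leq_trans (ltnW lt) (ltnW qc).
Qed.

(** Infinite descent: let [c] be the position of the block of [b] that follows
    [e].  By [walk] the point leaving [c] jumps over a block around [e] which
    ends before [c], so the block of [e] escapes from that block too. *)
Lemma no_escape (b e p : 'I_k) : minblk b < e -> e < maxblk b -> maxblk b < p ->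
  kappa e = kappa p -> False.
Proof.
elim: {b}(maxblk b).+1 {-2}b (ltnSn (maxblk b)) => // m IHm b bm be eb bp ep.
have [c /andP[/eqP cb ec] cmin] : {c : 'I_k | (kappa c == kappa b) && (e < c) &
    forall r, (kappa r == kappa b) && (e < r) -> c <= r}.
  case: (arg_minnP (i0 := maxblk b) (P := fun r => (kappa r == kappa b) && (e < r)) val).
    by rewrite maxblk_kappa eqxx eb.
  by move=> c; exists c.
have cm : c <= maxblk b by rewrite maxblk_ge.
have ne : kappa e != kappa b.
  by apply/eqP => eb'; have := maxblk_ge (etrans (esym ep) eb'); rewrite leqNgt bp.
have cmin' : c != minblk c.
  apply/eqP => e'; by have := ltn_trans be ec; rewrite -(minblk_eq cb) -e' ltnn.
have [p' + kp'] := stable c; rewrite (final_max w_star ker_w (nosing c)) (negPf cmin') => trc.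
have gap (r : 'I_k) : e < r < c -> kappa r != kappa c.
  move=> /andP[er rc]; apply/eqP => rc'; have := cmin r; rewrite er rc' cb eqxx.
  by move=> /(_ isT); rewrite leqNgt rc.
rewrite -cb in ne.
have [b' [b'm mb' eb' b'c]] := walk (leqnn c) ec ne gap trc kp'.
have ne' : kappa b' != kappa e.
  apply/eqP => e'; have := maxblk_ge (etrans (esym ep) (esym e')).
  by rewrite -b'm; lia.
apply: (IHm b' _ _ _ _ ep).
- by rewrite -b'm; lia.
- rewrite ltn_neqAle mb' andbT; apply: contra_neq ne' => e'.
  by rewrite -(minblk_kappa kappa b'); congr kappa; apply: val_inj.
- rewrite -b'm ltn_neqAle eb' andbT; apply: contra_neq ne' => e'.
  by congr kappa; apply: val_inj.
- by rewrite -b'm; lia.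
Qed.

(** If two blocks cross, then the one that ends last escapes from the other. *)
Lemma stable_crossing_free : crossing_free kappa.
Proof.
move=> a b c d ab bc cd eac ebd; apply/eqP; apply: contraT => ne.
case: (ltngtP (maxblk a) (maxblk b)) => [lt|lt|/val_inj e].
- case: (@no_escape a b (maxblk b)) => //; rewrite ?maxblk_kappa //.
    by apply: leq_ltn_trans ab; apply: minblk_le.
  by apply: leq_trans bc _; rewrite maxblk_ge.
- case: (@no_escape b c (maxblk a)) => //; rewrite ?maxblk_kappa //.
    by apply: leq_ltn_trans bc; apply: minblk_le.
  by apply: leq_trans cd _; rewrite maxblk_ge.
by move: ne; rewrite -(maxblk_kappa kappa a) e maxblk_kappa eqxx.
Qed.

End Converse.

Section LetterCycles.
Variables (X : finType) (star : X) (k : nat) (w : 'I_k -> X).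
Hypothesis w_star : forall p, w p != star.
Local Notation pi := (starperm star (codom w)).

Definition letters : {set X} := [set w p | p : 'I_k].
Definition cyc p : {set X} := porbit pi (w p).
Definition lcycles : {set {set X}} := [set cyc p | p : 'I_k].

Hypothesis pi_star : pi star = star.

Lemma lettersP x : reflect (exists p, x = w p) (x \in letters).
Proof. by apply: (iffP imsetP) => [[p _ ->]|[p ->]]; exists p. Qed.

Lemma w_letters p : w p \in letters. Proof. by apply/lettersP; exists p. Qed.

Lemma pi_out x : x \notin letters -> pi x = x.
Proof.
move=> xl; case: (eqVneq x star) => [->//|xs]; apply: starperm_out => //.
by apply: contra xl => /codomP[p ->]; exact: w_letters.
Qed.

Lemma pi_letters x : (pi x \in letters) = (x \in letters).
Proof.
apply/idP/idP => h; apply: contraT => /[dup] h'.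
  by move=> /pi_out e; rewrite e (negPf h') in h.
move=> /pi_out /perm_inj e; by rewrite e h in h'.
Qed.

Lemma cyc_sub p : cyc p \subset letters.
Proof.
apply/subsetP => x /porbitP[i ->]; elim: i => [|i IHi].
  by rewrite expg0 perm1 w_letters.
by rewrite expgSr permM pi_letters.
Qed.

Lemma cyc_eq p q : (cyc p == cyc q) = (w p \in cyc q).
Proof. exact: eq_porbit_mem. Qed.

Lemma mem_cyc p x : x \in cyc p -> exists2 q, x = w q & cyc q = cyc p.
Proof.
move=> xp; have /lettersP[q xq] := subsetP (cyc_sub p) x xp.
by exists q => //; apply/eqP; rewrite cyc_eq -xq.
Qed.

Lemma star_cyc p : star \notin cyc p.
Proof.
apply/negP => /(subsetP (cyc_sub p))/lettersP[q e].
by have := w_star q; rewrite -e eqxx.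
Qed.

Lemma lcycles_trivI : trivIset lcycles.
Proof.
apply/trivIsetP => _ _ /imsetP[p _ ->] /imsetP[q _ ->] ne.
apply/pred0P => x /=; apply/negP => /andP[xp xq]; case/eqP: ne.
by rewrite /cyc; move: xp xq; rewrite -!eq_porbit_mem => /eqP <- /eqP <-.
Qed.

Lemma cover_lcycles : cover lcycles = letters.
Proof.
apply/setP => x; apply/bigcupP/idP => [[_ /imsetP[p _ ->]]|/lettersP[p ->]].
  exact/subsetP/cyc_sub.
by exists (cyc p); [exact: imset_f|exact: porbit_id].
Qed.

Lemma sum_lcycles : \sum_(C in lcycles) #|C| = #|letters|.
Proof. by rewrite -cover_lcycles; apply/eqP; exact: lcycles_trivI. Qed.

Lemma porbits_lcycles : porbits pi = lcycles :|: [set [set x] | x in ~: letters].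
Proof.
apply/setP => C; rewrite inE; apply/imsetP/orP => [[x _ ->]|[/imsetP[p _ ->]|/imsetP[x]]].
- case: (boolP (x \in letters)) => [/lettersP[p ->]|xl]; first by left; apply: imset_f.
  by right; rewrite porbit1 ?pi_out //; apply: imset_f; rewrite inE.
- by exists (w p).
- by rewrite inE => xl ->; exists x => //; rewrite porbit1 ?pi_out.
Qed.

Lemma card_porbits_lcycles : #|porbits pi| + #|letters| = #|lcycles| + #|X|.
Proof.
rewrite porbits_lcycles cardsU disjoint_setI0 ?cards0 ?subn0.
  by rewrite card_imset; [rewrite -addnA (addnC #|~: _|) cardsC|exact: set1_inj].
apply/pred0P => C /=; apply/negP => /andP[/imsetP[p _ ->] /imsetP[x]].
rewrite inE => xl e; have := porbit_id pi (w p); rewrite -/(cyc p) e inE => /eqP e'.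
by rewrite -e' w_letters in xl.
Qed.

(** Here [star] is alone in its cycle and all other points that are not letters
    are fixed, so that [porbits_starperm] counts the letter cycles. *)
Lemma genus_word : exists g, k = #|letters| + #|lcycles| + g.*2.
Proof.
have sl : star \notin codom w.
  by apply/codomP => -[p e]; have := w_star p; rewrite -e eqxx.
have [g eg] := porbits_starperm sl; exists g.
have e1 : size (undup (codom w)) = #|letters|.
  rewrite -(card_uniqP (undup_uniq _)); apply: eq_card => x; rewrite mem_undup.
  by apply/codomP/lettersP.
have := card_porbits_lcycles; move: eg; rewrite e1 size_codom card_ord.
by move: #|porbits _| #|letters| #|lcycles| #|X| => *; lia.
Qed.

End LetterCycles.

(** * Words of genus 0 *)

Section Planar.
Variables (X : finType) (star : X) (k : nat) (w : 'I_k -> X).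
Hypothesis w_star : forall p, w p != star.
Local Notation pi := (starperm star (codom w)).
Hypothesis pi_star : pi star = star.
Local Notation cyc := (cyc star w).
Local Notation letters := (letters w).
Local Notation lcycles := (lcycles star w).
Local Notation minblk := (minblk cyc).
Local Notation maxblk := (maxblk cyc).
Local Notation part := (part star w).
Local Notation track := (track star w).

Lemma part_later q q' x : q <= q' <= k -> x != star ->
  (forall r : 'I_k, q <= r < q' -> w r != x) -> part q' x = part q x.
Proof.
move=> + xs; elim: q' => [|q' IHq'] /andP[qq q'k] later.
  by move: qq; rewrite leqn0 => /eqP ->.
move: qq; rewrite leq_eqVlt => /orP[/eqP -> //|]; rewrite ltnS => qq.
rewrite (partS star w (Ordinal q'k)) permM tpermD; last by rewrite eq_sym.
  by apply: IHq'; rewrite ?qq ?(ltnW q'k) // => r /andP[a b]; apply: later; rewrite a ltnW.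
by apply: later; rewrite /= qq ltnSn.
Qed.

(** If the letter occurred only once, its image would be found by tracing [star]
    from [p] to the left: it would be [star], which is a fixed point, or a
    letter of the same cycle occurring before [p]. *)
Lemma first_repeats p : p = minblk p -> exists2 r : 'I_k, r != p & w r = w p.
Proof.
move=> pm; case: (boolP [exists r, (r != p) && (w r == w p)]).
  by move=> /existsP[r /andP[rp /eqP e]]; exists r.
rewrite negb_exists => /forallP once.
have pik : part k = pi by exact: partk.
have e1 : pi (w p) = track p.
  rewrite -pik; apply: part_last; rewrite ?ltn_ord ?leqnn // => r /andP[pr _].
  by have := once r; rewrite negb_and negbK -val_eqE /= gtn_eqF.
have ts : track p != star.
  by rewrite -e1 -[X in _ != X]pi_star (inj_eq perm_inj) w_star.
case: (boolP [exists r : 'I_k, (r < p) && (w r == track p)]).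
  move=> /existsP[r /andP[rp /eqP e]].
  have : cyc r = cyc p.
    by apply/eqP; rewrite cyc_eq // e -e1; have := mem_porbit pi 1 (w p); rewrite expg1.
  by move=> /(minblk_le (kappa := cyc)); rewrite -pm leqNgt rp.
rewrite negb_exists => /forallP fresh.
have : part p (track p) = track p.
  apply: part_fresh => //; first exact: ltnW.
  by move=> r rp; have := fresh r; rewrite rp.
by move=> /perm_inj e; rewrite e eqxx in ts.
Qed.

(** The mirror image of [first_repeats]: the preimage of a letter occurring only
    at [p] would be [star] or a letter of its cycle occurring after [p]. *)
Lemma last_repeats p : p = maxblk p -> exists2 r : 'I_k, r != p & w r = w p.
Proof.
move=> pm; case: (boolP [exists r, (r != p) && (w r == w p)]).
  by move=> /existsP[r /andP[rp /eqP e]]; exists r.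
rewrite negb_exists => /forallP once.
have pik : part k = pi by exact: partk.
have tp : track p.+1 = w p.
  apply: track_fresh => // r rp.
  by have := once r; rewrite negb_and negbK -val_eqE /= ltn_eqF.
pose x := (pi^-1)%g (w p); have pix : pi x = w p by rewrite permKV.
have xs : x != star.
  by apply: contraTneq (w_star p) => e; rewrite -pix e pi_star eqxx.
case: (boolP [exists r : 'I_k, (p < r) && (w r == x)]).
  move=> /existsP[r /andP[pr /eqP e]].
  have : cyc r = cyc p.
    apply/eqP; rewrite cyc_eq // e [_ \in _]porbit_sym -pix.
    by have := mem_porbit pi 1 x; rewrite expg1.
  by move=> /(maxblk_ge (kappa := cyc)); rewrite -pm leqNgt pr.
rewrite negb_exists => /forallP late.
have : part k x = part p.+1 x.
  apply: part_later; rewrite ?ltn_ord ?leqnn // => r /andP[pr _].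
  by have := late r; rewrite pr.
by rewrite pik pix -tp => /esym /perm_inj e; rewrite e eqxx in xs.
Qed.

Definition block (C : {set X}) : {set 'I_k} := [set p | cyc p == C].

Lemma block_image p r : r \in block (cyc p) -> (exists2 t, t != r & w t = w r) ->
  w @: (block (cyc p) :\ r) = cyc p.
Proof.
rewrite inE => /eqP rp [t tr e]; apply/setP => x; apply/imsetP/idP => [[q]|].
  by rewrite !inE => /andP[_ /eqP <-] ->; exact: porbit_id.
move=> /(mem_cyc pi_star)[q -> qp].
case: (eqVneq q r) => [->|qr]; last by exists q => //; rewrite !inE qr qp eqxx.
exists t => //; rewrite !inE tr /= -rp; apply/eqP; rewrite /cyc e. done.
Qed.

Lemma minblk_block p : minblk p \in block (cyc p).
Proof. by rewrite inE (minblk_kappa cyc). Qed.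
Lemma maxblk_block p : maxblk p \in block (cyc p).
Proof. by rewrite inE (maxblk_kappa cyc). Qed.

Lemma minblk_image p : w @: (block (cyc p) :\ minblk p) = cyc p.
Proof.
apply: block_image; first exact: minblk_block.
apply: first_repeats; apply: minblk_eq; by rewrite minblk_kappa.
Qed.
Lemma maxblk_image p : w @: (block (cyc p) :\ maxblk p) = cyc p.
Proof.
apply: block_image; first exact: maxblk_block.
apply: last_repeats; apply: maxblk_eq; by rewrite maxblk_kappa.
Qed.

Lemma cyc_lcycles p : cyc p \in lcycles. Proof. exact: imset_f. Qed.

Lemma card_block_gt C : C \in lcycles -> #|C|.+1 <= #|block C|.
Proof.
case/imsetP=> p _ ->; rewrite (cardsD1 (minblk p)) minblk_block add1n ltnS.
by rewrite -{1}(minblk_image p) leq_imset_card.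
Qed.

Lemma sum_block : \sum_(C in lcycles) #|block C| = k.
Proof.
rewrite -[RHS]card_ord -sum1_card (partition_big cyc (mem lcycles)) => [|p _] /=; last exact: imset_f.
by apply: eq_bigr => C _; rewrite sum1dep_card.
Qed.

(** Genus 0, by [genus_word]. *)
Hypothesis planar : k = #|letters| + #|lcycles|.

(** Summing [card_block_gt] over the letter cycles gives an inequality between
    the two sides of [planar]. *)
Lemma card_block C : C \in lcycles -> #|block C| = #|C|.+1.
Proof.
move=> CL; have sum_eq : \sum_(C in lcycles) #|C|.+1 == \sum_(C in lcycles) #|block C|.
  apply/eqP; rewrite sum_block [RHS]planar -(sum_lcycles pi_star).
  rewrite -[#|lcycles|]sum1_card -big_split /=.
  by apply: eq_bigr => D _; rewrite addn1.
have := leqif_sum (fun (C : {set X}) (CL : C \in lcycles) => leqif_eq (card_block_gt CL)).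
by case=> _; rewrite sum_eq => /esym/forall_inP/(_ C CL)/eqP.
Qed.

Lemma planar_min_inj p : {in block (cyc p) :\ minblk p &, injective w}.
Proof.
apply/imset_injP; rewrite minblk_image.
have := card_block (cyc_lcycles p); rewrite -/(cyc p) (cardsD1 (minblk p)) minblk_block add1n.
by case=> ->.
Qed.
Lemma planar_max_inj p : {in block (cyc p) :\ maxblk p &, injective w}.
Proof.
apply/imset_injP; rewrite maxblk_image.
have := card_block (cyc_lcycles p); rewrite -/(cyc p) (cardsD1 (maxblk p)) maxblk_block add1n.
by case=> ->.
Qed.

Lemma planar_no_singleton : no_singleton cyc.
Proof.
move=> p; apply/eqP => e; have := card_block (cyc_lcycles p).
rewrite -/(cyc p) (cardsD1 (minblk p)) minblk_block add1n => -[].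
rewrite (cardsD1 (w p)) porbit_id (_ : _ :\ _ = set0) ?cards0 //.
apply/setP => q; rewrite !inE; apply/negbTE; rewrite negb_and negbK.
case: eqP => //= nq; apply/negP => /eqP qp; apply: nq; apply: val_inj; apply/eqP.
by rewrite /= eqn_leq minblk_le // andbT e maxblk_ge.
Qed.

(** A block has one position more than its cycle has letters, and all these
    letters are still there when its first, or its last, position is removed.
    So the single coincidence involves both ends. *)
Lemma planar_extreme_kernel : extreme_kernel w cyc.
Proof.
have fwd (p q : 'I_k) : p < q -> w p = w q -> p = minblk q /\ q = maxblk q.
  move=> pq e; have pq' : cyc p = cyc q by rewrite /cyc e.
  have pb : p \in block (cyc q) by rewrite inE pq'.
  have qb : q \in block (cyc q) by rewrite inE.
  have npq : p <> q by move=> e'; rewrite e' ltnn in pq.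
  split; apply/eqP; apply: contraT => ne; exfalso; apply: npq.
    apply: (@planar_min_inj q) => //; rewrite in_setD1 ?ne ?pb ?qb // andbT.
    by apply: contraTneq pq => ->; rewrite -leqNgt minblk_le.
  apply: (@planar_max_inj q) => //; rewrite in_setD1 ?ne ?pb ?qb // andbT.
  by apply: contraTneq pq => ->; rewrite -leqNgt maxblk_ge.
move=> p q pq; split; first exact: fwd.
move=> [pm qm]; have pq' : cyc p = cyc q by rewrite pm (minblk_kappa cyc).
have pm' : p = minblk p by rewrite (minblk_eq pq').
have [r rp e] := first_repeats pm'.
have pr : p < r.
  by rewrite ltn_neqAle eq_sym rp pm' minblk_le // /cyc e.
have [_ rm] := fwd _ _ pr (esym e).
have cr : cyc r = cyc q by rewrite -pq' /cyc e.
by rewrite -e rm (maxblk_eq cr) -qm.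
Qed.

Lemma cyc_stable p : exists2 p', pi (w p) = w p' & cyc p' = cyc p.
Proof.
have := mem_porbit pi 1 (w p); rewrite expg1 => /(mem_cyc pi_star)[p' e e'].
by exists p'.
Qed.

Lemma planar_crossing_free : crossing_free cyc.
Proof.
exact: (stable_crossing_free w_star planar_extreme_kernel planar_no_singleton cyc_stable).
Qed.

End Planar.

(** * Words with a given pattern of coincidences *)

Section Colour.
Variables (k : nat) (A : finType) (kappa : 'I_k -> A).
Hypothesis nosing : no_singleton kappa.
Local Notation minblk := (minblk kappa).
Local Notation maxblk := (maxblk kappa).

Definition nonmax : {set 'I_k} := [set p | p != maxblk p].

Lemma card_nonmax : #|nonmax| + #|[set kappa p | p : 'I_k]| = k.
Proof.
rewrite -[RHS]card_ord -(cardsC nonmax); congr (_ + _).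
have -> : [set kappa p | p : 'I_k] = kappa @: (~: nonmax).
  apply/setP => a; apply/imsetP/imsetP => -[p _ ->]; last by exists p.
  exists (maxblk p); last by rewrite maxblk_kappa.
  by rewrite !inE negbK (maxblk_eq (maxblk_kappa _ p)).
rewrite card_in_imset // => p q; rewrite !inE !negbK => /eqP pm /eqP qm e.
by rewrite pm qm (maxblk_eq e).
Qed.

(** When the letters coincide at the ends of the blocks only, the positions
    that do not end their block carry each letter once. *)
Definition rep p := if p == maxblk p then minblk p else p.

Lemma rep_nonmax p : rep p \in nonmax.
Proof.
rewrite inE /rep; case: (eqVneq p (maxblk p)) => // pm.
by rewrite (maxblk_eq (minblk_kappa _ p)) nosing.
Qed.

Lemma rep_eq (p q : 'I_k) : p < q ->
  (rep p == rep q) = (p == minblk q) && (q == maxblk q).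
Proof.
move=> pq; rewrite /rep; case: (eqVneq q (maxblk q)) => [qm|qm]; last first.
  rewrite andbF; case: (eqVneq p (maxblk p)) => [pm|_]; last first.
    by rewrite -val_eqE /= ltn_eqF.
  apply/eqP => e; have := @minblk_le _ _ kappa p p erefl.
  by rewrite e leqNgt pq.
rewrite andbT; case: (eqVneq p (maxblk p)) => [pm|//]; apply/eqP/eqP => e; last first.
  by move: pq; rewrite pm qm e (maxblk_eq (minblk_kappa _ q)) ltnn.
have e' : kappa p = kappa q by rewrite -(minblk_kappa kappa p) e minblk_kappa.
by move: pq; rewrite pm qm (maxblk_eq e') ltnn.
Qed.

(** Such a word is an injective choice of the letters at the positions that do
    not end their block. *)
Lemma card_extreme_kernel n :
  #|[set w : {ffun 'I_k -> 'I_n} | [forall p : 'I_k, forall q : 'I_k, (p < q) ==>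
      ((w p == w q) == ((p == minblk q) && (q == maxblk q)))]]| = n ^_ #|nonmax|.
Proof.
pose D := {p : 'I_k | p \in nonmax}.
pose repD p : D := Sub (rep p) (rep_nonmax p).
have card_D : #|{: D}| = #|nonmax| by rewrite card_sig; apply: eq_card => p; rewrite inE.
have repK (d : D) : repD (val d) = d.
  apply: val_inj => /=; have := valP d; rewrite inE /rep.
  by move=> /negPf ->.
pose psi (f : {ffun D -> 'I_n}) : {ffun 'I_k -> 'I_n} := [ffun p => f (repD p)].
have psi_inj : injective psi.
  move=> f g /ffunP e; apply/ffunP => d; have := e (val d).
  by rewrite !ffunE repK.
rewrite -[X in X ^_ _]card_ord -card_D -card_inj_ffuns -(card_imset _ psi_inj).
apply: eq_card => w; rewrite inE; apply/idP/imsetP => [kerw|[f]].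
  have kw (p q : 'I_k) : p < q -> (w p == w q) = (rep p == rep q).
    by move=> pq; rewrite rep_eq //; have /forallP/(_ p)/forallP/(_ q) := kerw; rewrite pq => /eqP.
  have wrep p : w (rep p) = w p.
    rewrite /rep; case: (eqVneq p (maxblk p)) => // pm.
    have lt : minblk p < p.
      by rewrite ltn_neqAle minblk_le // andbT {2}pm nosing.
    apply/eqP; rewrite kw // /rep -pm eqxx (maxblk_eq (minblk_kappa _ p)).
    by rewrite (negPf (nosing p)).
  exists [ffun d : D => w (val d)]; last first.
    by apply/ffunP => p; rewrite !ffunE /= wrep.
  rewrite inE; apply/injectiveP => d e; rewrite !ffunE => we.
  have re : rep (val d) = rep (val e).
    case: (ltngtP (val d) (val e)) => [lt|lt|/val_inj ->] //.
      by apply/eqP; rewrite -kw // we.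
    by apply/esym/eqP; rewrite -kw // we.
  by rewrite -(repK d) -(repK e); apply: val_inj.
rewrite inE => /injectiveP f_inj ->.
apply/forallP => p; apply/forallP => q; apply/implyP => pq.
by rewrite !ffunE (inj_eq f_inj) -rep_eq // -val_eqE.
Qed.

End Colour.

Section PlanarWords.
Variables (X : finType) (star : X) (k : nat) (w : 'I_k -> X).
Hypothesis w_star : forall p, w p != star.
Local Notation pi := (starperm star (codom w)).
Variables (A : finType) (kappa : 'I_k -> A).
Hypothesis ker_w : extreme_kernel w kappa.
Hypothesis noncr : crossing_free kappa.
Hypothesis nosing : no_singleton kappa.

Let pi_star : pi star = star.
Proof. exact: (starperm_star w_star ker_w noncr nosing). Qed.

Lemma kernel_rep p q : (w p == w q) = (rep kappa p == rep kappa q).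
Proof.
have main (r t : 'I_k) : r < t -> (w r == w t) = (rep kappa r == rep kappa t).
  move=> rt; rewrite rep_eq //; apply/eqP/andP => [/(ker_w rt)[<- <-]|[/eqP a /eqP b]].
    by rewrite !eqxx.
  by apply/ker_w.
case: (ltngtP p q) => [|qp|/val_inj ->]; [exact: main| |by rewrite !eqxx].
by rewrite eq_sym main // eq_sym.
Qed.

Lemma card_kernel_letters : #|letters w| = #|nonmax kappa|.
Proof.
have -> : letters w = w @: nonmax kappa.
  apply/setP => x; apply/imsetP/imsetP => -[p _ ->]; last by exists p.
  exists (rep kappa p); first exact: rep_nonmax.
  apply/eqP; rewrite kernel_rep; have := rep_nonmax nosing p.
  by rewrite inE /rep => /negPf ->.
rewrite card_in_imset // => p q; rewrite !inE => pm qm /eqP; rewrite kernel_rep.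
by rewrite /rep (negPf pm) (negPf qm) => /eqP.
Qed.

Lemma cyc_kappa p q : cyc star w p = cyc star w q -> kappa p = kappa q.
Proof.
move=> e; have : w p \in cyc star w q by rewrite -e porbit_id.
move=> /porbitP[i]; suff: exists2 q', (pi ^+ i)%g (w q) = w q' & kappa q' = kappa q.
  by move=> [q' -> <-] /(extreme_kernel_block ker_w).
elim: i => [|i [q' e1 e2]]; first by exists q; rewrite // expg0 perm1.
have [q'' e3 e4] := starperm_block w_star ker_w noncr nosing q'.
by exists q''; rewrite ?e4 // expgSr permM e1.
Qed.

Let kap C : option A := omap kappa [pick p | cyc star w p == C].

Let kap_cyc p : kap (cyc star w p) = Some (kappa p).
Proof.
rewrite /kap; case: pickP => [q /eqP /cyc_kappa /= ->//|/(_ p)]; by rewrite eqxx.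
Qed.

Let image_kap : kap @: lcycles star w = some @: [set kappa p | p : 'I_k].
Proof.
rewrite -!imset_comp; apply: eq_imset => p /=; exact: kap_cyc.
Qed.

Let someI : injective (@Some A).
Proof. by move=> a b []. Qed.

(** Blocks are unions of cycles, which gives one inequality; the other one is
    the genus formula, as there are [k] minus the number of blocks letters. *)
Lemma card_kernel_cycles : #|lcycles star w| = #|[set kappa p | p : 'I_k]|.
Proof.
have le : #|[set kappa p | p : 'I_k]| <= #|lcycles star w|.
  rewrite -(card_imset _ someI) -image_kap; exact: leq_imset_card.
have [g] := genus_word w_star pi_star; have := card_nonmax kappa.
rewrite card_kernel_letters; move: le.
by move: #|_| #|_| #|_| => *; lia.
Qed.

Lemma kernel_planar : k = #|letters w| + #|lcycles star w|.
Proof. by rewrite card_kernel_letters card_kernel_cycles card_nonmax. Qed.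

(** Sending a letter cycle to its block is onto, hence injective by
    [card_kernel_cycles]. *)
Lemma cyc_kappaE p q : (cyc star w p == cyc star w q) = (kappa p == kappa q).
Proof.
apply/eqP/eqP => [|e]; first exact: cyc_kappa.
have : {in lcycles star w &, injective kap}.
  by apply/imset_injP; rewrite image_kap (card_imset _ someI) card_kernel_cycles.
by apply; rewrite ?cyc_lcycles // !kap_cyc e.
Qed.

End PlanarWords.

(** * Counting words of genus 0 by noncrossing partitions *)

Lemma perm_image_imset (A B : finType) (C : eqType) (f : A -> B) (g : B -> C) (D : {set A}) :
  {in D &, injective f} ->
  perm_eq [seq g b | b in f @: D] [seq g (f a) | a in D].
Proof.
move=> f_inj; rewrite /image_mem (map_comp g f); apply: perm_map.
apply: uniq_perm; rewrite ?enum_uniq //.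
  by rewrite map_inj_in_uniq ?enum_uniq // => x y; rewrite !mem_enum; exact: f_inj.
move=> b; rewrite mem_enum; apply/imsetP/mapP => -[a aD ->]; exists a => //.
  by rewrite mem_enum.
by rewrite -mem_enum.
Qed.

Section YbarRows.
Variables (k : nat) (s : young).
Hypothesis sY : s \in Ybar k.

Lemma Ybar_boxes : boxes s = k.
Proof. by move: sY; rewrite mem_Ybar => /andP[/eqP]. Qed.

Lemma Ybar_rows r : r \in rows s -> 1 < r.
Proof.
move=> rs; have /andP[_ s0] := rowsP s.
move: sY; rewrite mem_Ybar => /andP[_]; rewrite /nrow => /eqP/count_memPn s1.
by case: r rs => [|[|r]] // h; [rewrite h in s0|case/negP: s1].
Qed.

(** No row is lost together with the first column, because all rows have at
    least two boxes. *)
Lemma perm_strip : perm_eq [seq r.+1 | r <- strip s] s.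
Proof.
have -> : rows s = [seq r.+1 | r <- [seq r.-1 | r <- s]] :> seq nat.
  by rewrite -map_comp map_id_in // => r /Ybar_rows; case: r.
apply: perm_map; rewrite /= perm_sort.
have /all_filterP -> // : all (fun r => 0 < r) [seq r.-1 | r <- s].
by apply/allP => _ /mapP[r /Ybar_rows + ->]; case: r => [|[]].
Qed.

Lemma size_strip : size (strip s) = nrows s.
Proof. by have := perm_size perm_strip; rewrite size_map. Qed.

Lemma boxes_strip : boxes (strip s) + nrows s = k.
Proof.
rewrite -Ybar_boxes /boxes -(perm_sumn perm_strip) -size_strip.
by elim: (rows (strip s)) => //= r t IHt; lia.
Qed.

End YbarRows.

Section ColourInvariance.
Variables (k : nat) (A B : eqType) (f : 'I_k -> A) (g : 'I_k -> B).
Hypothesis fg : forall p q, (f p == f q) = (g p == g q).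

Lemma minblk_colour p : minblk f p = minblk g p.
Proof.
apply/val_inj/eqP; rewrite /= eqn_leq !minblk_le //; apply/eqP.
  by rewrite -fg minblk_kappa.
by rewrite fg minblk_kappa.
Qed.

Lemma maxblk_colour p : maxblk f p = maxblk g p.
Proof.
apply/val_inj/eqP; rewrite /= eqn_leq !maxblk_ge //; apply/eqP.
  by rewrite fg maxblk_kappa.
by rewrite -fg maxblk_kappa.
Qed.

Lemma crossing_free_colour : crossing_free f -> crossing_free g.
Proof.
move=> cf a b c d ab bc cd /eqP ac /eqP bd; apply/eqP; rewrite -fg; apply/eqP.
by apply: (cf a b c d) => //; apply/eqP; rewrite fg.
Qed.

Lemma extreme_kernel_colour (X : finType) (w : 'I_k -> X) :
  extreme_kernel w f -> extreme_kernel w g.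
Proof. by move=> kw p q pq; rewrite -minblk_colour -maxblk_colour; exact: kw. Qed.

End ColourInvariance.

Section PlanarCount.
Variables (k n : nat).
Implicit Types (w : {ffun 'I_k -> 'I_n}) (P : {set {set 'I_k}}).

(** The star is the last of the n+1 points, which is not a letter. *)
Definition lword w : 'I_k -> 'I_n.+1 := fun p => lift ord_max (w p).
Notation star := (@ord_max n).

Lemma lword_star w p : lword w p != star.
Proof. by rewrite eq_sym neq_lift. Qed.

Definition wcycles w := lcycles star (lword w).
Definition wpi w := starperm star (codom (lword w)).
Definition wblocks w := preim_partition (cyc star (lword w)) [set: 'I_k].

(** The words of genus 0 and shape [s]; it is the number of letters that
    expresses genus 0. *)
Definition planar_words (s : young) : {set {ffun 'I_k -> 'I_n}} :=
  [set w | [&& wpi w star == star, #|letters (lword w)| == k - nrows s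
             & perm_eq [seq #|C| | C : {set 'I_n.+1} in wcycles w] (strip s)]].

Lemma pblock_wblocks w p q :
  (pblock (wblocks w) p == pblock (wblocks w) q) = (cyc star (lword w) p == cyc star (lword w) q).
Proof.
have /and3P[/eqP cov tI _] := preim_partitionP (cyc star (lword w)) [set: 'I_k].
rewrite eq_pblock ?cov ?inE // pblock_equivalence_partition ?inE //.
by move=> x y z _ _ _; split=> // /eqP ->.
Qed.

Lemma wblocks_image w : wblocks w = block star (lword w) @: wcycles w.
Proof.
apply/setP => B; apply/imsetP/imsetP => [[p _ ->]|[_ /imsetP[p _ ->] ->]].
  exists (cyc star (lword w) p); first exact: imset_f.
  by apply/setP => q; rewrite !inE /= eq_sym.
exists p; rewrite ?inE //.
by apply/setP => q; rewrite !inE /= eq_sym.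
Qed.

Lemma block_inj w : {in wcycles w &, injective (block star (lword w))}.
Proof.
move=> _ _ /imsetP[p _ ->] /imsetP[q _ ->] /setP/(_ p).
by rewrite !inE eqxx => /esym/eqP.
Qed.

Lemma perm_block_sizes w : k = #|letters (lword w)| + #|wcycles w| -> wpi w star = star ->
  perm_eq [seq #|B| | B : {set 'I_k} in wblocks w]
          [seq r.+1 | r <- [seq #|C| | C : {set 'I_n.+1} in wcycles w]].
Proof.
move=> planar pis; rewrite wblocks_image.
apply: perm_trans (perm_image_imset _ (@block_inj w)) _.
have -> // : [seq #|block star (lword w) C| | C in wcycles w] =
         [seq r.+1 | r <- [seq #|C| | C : {set 'I_n.+1} in wcycles w]].
rewrite /image_mem -map_comp; apply/eq_in_map => C; rewrite mem_enum => CL /=.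
exact: (card_block (@lword_star w) pis planar CL).
Qed.

Lemma crossing_free_noncrossing P : crossing_free (pblock P) ->
  finset.partition P [set: 'I_k] -> noncrossing P.
Proof.
move=> cf /and3P[/eqP cov tI _].
apply/forall_inP => A AP; apply/forall_inP => B BP; apply/implyP => AB.
apply/negP => /exists_inP[a aA /exists_inP[b bB /exists_inP[c cA /exists_inP[d dB /and3P[ab bc cd]]]]].
case/eqP: AB; rewrite -(def_pblock tI AP aA) -(def_pblock tI BP bB).
by apply: (cf a b c d) => //; rewrite ?(def_pblock tI AP aA) ?(def_pblock tI AP cA)
  ?(def_pblock tI BP bB) ?(def_pblock tI BP dB).
Qed.

Lemma noncrossing_crossing_free P : noncrossing P ->
  finset.partition P [set: 'I_k] -> crossing_free (pblock P).
Proof.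
move=> nc /and3P[/eqP cov tI _] a b c d ab bc cd ac bd.
have PP x : pblock P x \in P by rewrite pblock_mem // cov inE.
have xP x : x \in pblock P x by rewrite mem_pblock cov inE.
apply/eqP; move/forall_inP: nc => /(_ _ (PP a))/forall_inP/(_ _ (PP b)).
case: eqP => //= _ /negP[]; apply/exists_inP; exists a => //.
apply/exists_inP; exists b => //; apply/exists_inP; exists c; first by rewrite ac.
by apply/exists_inP; exists d; rewrite ?bd // ab bc cd.
Qed.

Lemma planar_words_genus s w : s \in Ybar k -> w \in planar_words s ->
  k = #|letters (lword w)| + #|wcycles w|.
Proof.
move=> sY; rewrite inE => /and3P[_ /eqP -> pe].
have -> : #|wcycles w| = nrows s.
  by rewrite -(size_strip sY) -(perm_size pe) size_map cardE.
by have := boxes_strip sY; lia.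
Qed.

Lemma wblocks_NC s w : s \in Ybar k -> w \in planar_words s -> wblocks w \in NC k s.
Proof.
move=> sY wW; have planar := planar_words_genus sY wW.
move: wW; rewrite inE => /and3P[/eqP pis dw pe].
have ptn := preim_partitionP (cyc star (lword w)) [set: 'I_k].
rewrite inE ptn crossing_free_noncrossing //=.
  apply: perm_trans (perm_block_sizes planar pis) _.
  by apply: perm_trans (perm_strip sY); exact: perm_map.
apply: crossing_free_colour (planar_crossing_free (@lword_star w) pis planar) => p q.
by rewrite pblock_wblocks.
Qed.

Lemma no_singleton_NC s P : s \in Ybar k -> P \in NC k s -> no_singleton (pblock P).
Proof.
move=> sY; rewrite inE => /and3P[/and3P[/eqP cov tI _] _ pe] p; apply/eqP => e.
have PP : pblock P p \in P by rewrite pblock_mem // cov inE.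
have : #|pblock P p| \in rows s.
  by rewrite -(perm_mem pe); apply: image_f.
move=> /(Ybar_rows sY); rewrite (_ : pblock P p = [set p]) ?cards1 //.
apply/setP => q; rewrite inE; apply/idP/eqP => [qp|->]; last by rewrite mem_pblock cov inE.
have eqp := same_pblock tI qp.
apply/val_inj/eqP; rewrite /= eqn_leq.
have l1 := minblk_le eqp; have l2 := maxblk_ge eqp.
have l3 := minblk_le (erefl (pblock P p)); have l4 := maxblk_ge (erefl (pblock P p)).
by move: l1 l2 l3 l4; rewrite e; lia.
Qed.

Lemma card_NC_blocks s P : P \in NC k s -> #|[set pblock P p | p : 'I_k]| = nrows s.
Proof.
rewrite inE => /and3P[/and3P[/eqP cov tI P0] _ pe].
rewrite /nrows -(perm_size pe) size_map -cardE; apply: eq_card => B.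
apply/imsetP/idP => [[p _ ->]|BP]; first by rewrite pblock_mem // cov inE.
have /set0Pn[p pB] : B != set0 by apply: contraNneq P0 => <-.
by exists p => //; rewrite (def_pblock tI BP pB).
Qed.

(** Genus 0 forces the coincidences to be at the ends of the blocks.
    Conversely, such coincidences along a noncrossing partition force genus 0,
    and the cycles then recover the partition. *)
Lemma planar_words_fiber s P : s \in Ybar k -> P \in NC k s ->
  [set w in planar_words s | wblocks w == P] =
  [set w : {ffun 'I_k -> 'I_n} | [forall p : 'I_k, forall q : 'I_k, (p < q) ==>
      ((w p == w q) == ((p == minblk (pblock P) q) && (q == maxblk (pblock P) q)))]].
Proof.
move=> sY PN; apply/setP => w; rewrite [LHS]inE [RHS]inE.
have kerE : reflect (extreme_kernel (lword w) (pblock P))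
   [forall p : 'I_k, forall q : 'I_k, (p < q) ==>
      ((w p == w q) == ((p == minblk (pblock P) q) && (q == maxblk (pblock P) q)))].
  apply: (iffP forallP) => [h p q pq|h p].
    have /forallP/(_ q) := h p; rewrite pq /= => /eqP e; rewrite /lword.
    split=> [/lift_inj /eqP|[/eqP a /eqP b]]; first by rewrite e => /andP[/eqP ? /eqP ?].
    by congr lift; apply/eqP; rewrite e a b.
  apply/forallP => q; apply/implyP => pq; have hpq := h p q pq; apply/eqP.
  apply/eqP/andP => [e|[/eqP a /eqP b]]; last by apply: (@lift_inj _ star); apply/hpq.
  by have [+ _] := hpq; case; rewrite /lword ?e // => <- <-; rewrite !eqxx.
apply/andP/kerE => [[wW /eqP wP]|ker_w].
  have planar : k = #|letters (lword w)| + #|wcycles w|.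
    exact: planar_words_genus sY wW.
  move: wW; rewrite inE => /and3P[/eqP pis _ _].
  apply: extreme_kernel_colour (planar_extreme_kernel (@lword_star w) pis planar) => p q.
  by rewrite -wP pblock_wblocks.
have ns := no_singleton_NC sY PN.
have [ptn nc pe] : [/\ finset.partition P [set: 'I_k], noncrossing P
                     & perm_eq [seq #|B| | B : {set 'I_k} in P] s].
  by apply/and3P; move: PN; rewrite inE.
have cf := noncrossing_crossing_free nc ptn.
have cE := cyc_kappaE (@lword_star w) ker_w cf ns.
have planar := kernel_planar (@lword_star w) ker_w cf ns.
have pis : wpi w star = star by exact: (starperm_star (@lword_star w) ker_w cf ns).
have wP : wblocks w = P.
  rewrite -(preim_partition_pblock ptn); apply: eq_in_imset => p _.
  by apply/setP => q; rewrite !inE /= cE.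
split; last by rewrite wP.
rewrite inE pis eqxx /=; apply/andP; split.
  rewrite (card_kernel_letters ker_w ns) -(card_NC_blocks PN).
  by have := card_nonmax (pblock P); move: #|_| #|_| => *; apply/eqP; lia.
have := perm_block_sizes planar pis; rewrite wP => pe2.
apply: (perm_map_inj succn_inj); apply: (@perm_trans _ s).
  by rewrite perm_sym in pe2; exact: perm_trans pe2 pe.
by rewrite perm_sym; exact: (perm_strip sY).
Qed.

Lemma card_planar_words s : s \in Ybar k ->
  #|planar_words s| = #|NC k s| * n ^_ (k - nrows s).
Proof.
move=> sY; rewrite -sum1_card (partition_big wblocks (mem (NC k s))) /=; last first.
  by move=> w; exact: wblocks_NC.
rewrite -sum_nat_const; apply: eq_bigr => P PN.
rewrite sum1dep_card.
rewrite (planar_words_fiber sY PN) card_extreme_kernel; last exact: no_singleton_NC PN.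
congr (_ ^_ _); have := card_nonmax (pblock P); rewrite (card_NC_blocks PN).
by move: #|_| => *; lia.
Qed.

End PlanarCount.

(** * Charges of the letter cycles *)

Section WreathStep.
Local Open Scope group_scope.
Variables (T : finGroupType) (n : nat).
Implicit Types (g h : wreath T n).

Lemma wpermM g h : wperm (g * h) = wperm h * wperm g.
Proof. by []. Qed.

Lemma wbaseM g h i : wbase (g * h) i = wbase g i * wbase h ((wperm g)^-1 i).
Proof. by rewrite /= ffunE. Qed.

Lemma wreath_eq g h : wbase g =1 wbase h -> wperm g = wperm h -> g = h.
Proof. by case: g h => [b s] [b' s'] /= /ffunP -> ->. Qed.

(** For the last point as the star, a summand of the Jucys-Murphy element. *)
Definition wstep (star a : 'I_n) (x : T) : wreath T n :=
  wat x^-1 a * wat x star * wtperm T a star.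

Definition sbase (star a : 'I_n) (x : T) (i : 'I_n) : T :=
  if i == star then x else if i == a then x^-1 else 1.

Lemma wperm_step star a x : wperm (wstep star a x) = tperm a star.
Proof. by rewrite /wstep !wpermM /= !mulg1. Qed.

Lemma wbase_step star a x i : a != star -> wbase (wstep star a x) i = sbase star a x i.
Proof.
move=> an; rewrite /wstep !wbaseM /= !ffunE /= invg1 perm1 mulg1 /sbase.
by case: (eqVneq i star) => [->|_]; [rewrite eq_sym (negPf an) mul1g|rewrite mulg1].
Qed.

End WreathStep.

Section WreathWord.
Local Open Scope group_scope.
Variables (T : finGroupType) (n : nat) (star : 'I_n).

Definition wword k (w : 'I_k -> 'I_n) (x : 'I_k -> T) : wreath T n :=
  \prod_(p < k) wstep star (w p) (x p).

Lemma codom_ordS k (X : Type) (w : 'I_k.+1 -> X) :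
  codom w = rcons (codom (fun p : 'I_k => w (widen_ord (leqnSn k) p))) (w ord_max).
Proof. by rewrite /codom /image_mem enum_ordSr map_rcons -map_comp. Qed.

Lemma wperm_word k (w : 'I_k -> 'I_n) x : wperm (wword w x) = starperm star (codom w).
Proof.
rewrite /wword; elim: k w x => [|k IHk] w x.
  by rewrite big_ord0 (_ : codom w = [::]) //; apply/nilP; rewrite /nilp size_codom card_ord.
by rewrite big_ord_recr wpermM IHk wperm_step codom_ordS starperm_rcons.
Qed.

Lemma wbase_word k (w : 'I_k -> 'I_n) x i : (forall p, w p != star) ->
  wbase (wword w x) i = \prod_(p < k) sbase star (w p) (x p) ((part star w p)^-1 i).
Proof.
rewrite /wword; elim: k w x => [|k IHk] w x w_star; first by rewrite !big_ord0 /= ffunE.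
rewrite !big_ord_recr wbaseM IHk // wbase_step // -/(wword _ _) wperm_word.
have sz : size (codom (fun p : 'I_k => w (widen_ord (leqnSn k) p))) = k by rewrite size_codom card_ord.
congr (_ * _); last first.
  by rewrite /part codom_ordS -cats1 take_size_cat.
apply: eq_bigr => p _; rewrite /part codom_ordS -cats1 takel_cat //.
by rewrite sz; exact: ltnW (ltn_ord p).
Qed.

End WreathWord.

Section Charges.
Local Open Scope group_scope.
Variables (T : finGroupType) (abelT : abelian [set: T]).

Lemma abel_mulC : commutative (@mulg T).
Proof. by move=> x y; apply: (centsP abelT); rewrite inE. Qed.

#[local] HB.instance Definition _ := SemiGroup.isCommutativeLaw.Build T (@mulg T) abel_mulC.

Section Word.
Variables (n : nat) (star : 'I_n) (k : nat) (w : 'I_k -> 'I_n).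
Hypothesis w_star : forall p, w p != star.
Local Notation pi := (starperm star (codom w)).
Hypothesis pi_star : pi star = star.
Local Notation cyc := (cyc star w).
Local Notation LC := (lcycles star w).
Local Notation part := (part star w).

(** For a cycle [C] of the product this is the element x of [T] such that [C] is
    an (x, p)-cycle. *)
Definition charge (x : 'I_k -> T) (C : {set 'I_n}) : T :=
  \prod_(i in C) wbase (wword star w x) i.

(** The factor at position [p] has two nontrivial entries, inverse to each
    other, at [star] and at its letter; the factors before it move them to the
    images of these two points under [part p]. *)
Lemma chargeE x C : charge x C =
  \prod_(p < k) ((if part p star \in C then x p else 1) *
                 (if part p (w p) \in C then (x p)^-1 else 1)).
Proof.
rewrite /charge; under eq_bigr => i _ do rewrite wbase_word //.
rewrite exchange_big /=; apply: eq_bigr => p _.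
rewrite (reindex_inj (@perm_inj _ (part p))) /=.
under eq_bigr => i _ do rewrite permK.
have sE i : sbase star (w p) (x p) i = (if i == star then x p else 1) * (if i == w p then (x p)^-1 else 1).
  rewrite /sbase; case: (eqVneq i star) => [->|_]; last by rewrite mul1g.
  by rewrite eq_sym (negPf (w_star p)) mulg1.
under eq_bigr => i _ do rewrite sE.
rewrite big_split /=; congr (_ * _).
  rewrite -big_mkcondr /=; case: ifP => sC.
    by rewrite (big_pred1 star) // => i; rewrite /= andbC; case: eqP => // ->.
  by rewrite big_pred0 // => i; rewrite andbC; case: eqP => // ->.
rewrite -big_mkcondr /=; case: ifP => sC.
  by rewrite (big_pred1 (w p)) // => i; rewrite /= andbC; case: eqP => // ->.
by rewrite big_pred0 // => i; rewrite andbC; case: eqP => // ->.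
Qed.

Lemma chargeM x x' C : charge (fun p => x p * x' p) C = charge x C * charge x' C.
Proof.
rewrite !chargeE -big_split; apply: eq_bigr => p _ /=.
case: ifP => _; case: ifP => _; rewrite ?mul1g ?mulg1 //.
  by rewrite !mulgV mulg1.
by rewrite invMg abel_mulC.
Qed.

Lemma eq_charge x x' C : x =1 x' -> charge x C = charge x' C.
Proof. by move=> e; rewrite !chargeE; apply: eq_bigr => p _; rewrite e. Qed.

Lemma charge_ffun1 C : charge (fun=> 1) C = 1.
Proof. by rewrite chargeE big1 // => p _; rewrite invg1 !if_same mulg1. Qed.

Lemma part_star (p : 'I_k) : part p star = star \/ exists2 r : 'I_k, r < p & part p star = w r.
Proof.
case: (eqVneq (part p star) star) => ts; [by left|right].
case: (boolP [exists r : 'I_k, (r < p) && (w r == part p star)]).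
  by move=> /existsP[r /andP[rp /eqP e]]; exists r.
rewrite negb_exists => /forallP fresh.
have : part p (part p star) = part p star.
  apply: part_fresh => //; first exact: ltnW.
  by move=> r rp; have := fresh r; rewrite rp.
by move=> /perm_inj e; rewrite e eqxx in ts.
Qed.

(** Triangularity: if [m] is the first position of a cycle, its label appears in
    the charge of this cycle, because the letters before [m] do not move the
    letter at [m].  It appears in at most one other charge, that of the cycle
    containing the image of [star] under the letters before [m], and this cycle
    starts earlier.  So the charges can be adjusted one after the other, the
    cycle that starts last being the first. *)
Lemma charge_surj_prefix m (chi : {set 'I_n} -> T) : m <= k ->
  (forall C, C \in LC -> chi C != 1 -> exists2 p : 'I_k, p < m & cyc p = C) ->
  exists x : {ffun 'I_k -> T}, forall C, C \in LC -> charge x C = chi C.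
Proof.
elim: m chi => [|m IHm] chi mk supp.
  exists [ffun=> 1] => C CL; rewrite (eq_charge (x' := fun=> 1)); last by move=> p; rewrite ffunE.
  rewrite charge_ffun1; case: (eqVneq (chi C) 1) => [->//|ne].
  by have [p] := supp C CL ne; rewrite ltn0.
pose p0 := Ordinal mk.
case: (boolP [exists p : 'I_k, (p < m) && (cyc p == cyc p0)]).
  move=> /existsP[p /andP[pm /eqP ep]]; apply: IHm; first exact: ltnW.
  move=> C CL ne; have [q + qC] := supp C CL ne.
  rewrite ltnS leq_eqVlt => /orP[/eqP qm|qm]; last by exists q.
  by exists p => //; rewrite ep -qC; congr cyc; apply: val_inj.
rewrite negb_exists => /forallP first_p0.
have first_cyc (r : 'I_k) : r < m -> cyc r != cyc p0.
  by move=> rm; have := first_p0 r; rewrite rm.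
(* A letter receives the inverse of its label. *)
pose t := (chi (cyc p0))^-1.
pose d (p : 'I_k) := if p == p0 then t else 1.
have dE C : charge d C = (if part p0 star \in C then t else 1) * (if w p0 \in C then t^-1 else 1).
  rewrite chargeE (bigD1 p0) //= big1 ?mulg1.
    rewrite /d eqxx (_ : part p0 (w p0) = w p0) //; apply: part_fresh => //; first exact: ltnW.
    move=> r rp; apply: contra_neq (first_cyc r rp); rewrite /cyc; by move=> ->.
  by move=> p /negPf np; rewrite /d np invg1 !if_same mulg1.
have dp0 : charge d (cyc p0) = chi (cyc p0).
  rewrite dE porbit_id invgK; case: ifP; rewrite ?mul1g //.
  case: (part_star p0) => [->|[r rp ->]]; first by rewrite (negPf (star_cyc w_star pi_star p0)).
  by rewrite -cyc_eq // (negPf (first_cyc r rp)).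
have [||x ex] := IHm (fun C => chi C * (charge d C)^-1); first exact: ltnW.
  move=> C CL; case: (eqVneq C (cyc p0)) => [->|nC]; first by rewrite dp0 mulgV eqxx.
  case: (eqVneq (chi C) 1) => [->|ne _]; last first.
    have [p + pC] := supp C CL ne; rewrite ltnS leq_eqVlt => /orP[/eqP pm|pm]; last by exists p.
    by case/eqP: nC; rewrite -pC; congr cyc; apply: val_inj.
  have /imsetP[q _ Cq] := CL.
  have -> : charge d C = if part p0 star \in C then t else 1.
    rewrite dE; case: (boolP (w p0 \in C)) => [h|_]; last by rewrite mulg1.
    by case/eqP: nC; rewrite Cq -cyc_eq // in h *; move/eqP: h => ->.
  case: ifP => [pC _|]; last by rewrite invg1 mulg1 eqxx.
  case: (part_star p0) pC => [->|[r rp ->]]; first by rewrite Cq (negPf (star_cyc w_star pi_star q)).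
  by rewrite Cq -cyc_eq // => /eqP e; exists r.
exists [ffun p => x p * d p] => C CL.
rewrite (eq_charge (x' := fun p => x p * d p)); last by move=> p; rewrite ffunE.
by rewrite chargeM ex // mulgKV.
Qed.

Definition charges (x : {ffun 'I_k -> T}) : {ffun {set 'I_n} -> T} :=
  [ffun C => if C \in LC then charge x C else 1].

Lemma charges_surj (chi : {ffun {set 'I_n} -> T}) : chi \in pffun_on 1 (mem LC) predT ->
  exists x, charges x = chi.
Proof.
move=> /pfamilyP[/supportP supp _].
have [||x ex] := @charge_surj_prefix k chi; first exact: leqnn.
  by move=> C /imsetP[p _ ->] _; exists p.
exists x; apply/ffunP => C; rewrite ffunE; case: ifP => [/ex ->//|CL].
by rewrite supp ?CL.
Qed.

(** By [chargeM] and [charges_surj] the fibres are translates of each other, so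
    they all have the same size. *)
Lemma card_charges (chi : {ffun {set 'I_n} -> T}) : chi \in pffun_on 1 (mem LC) predT ->
  (#|[set x | charges x == chi]| * #|T| ^ #|LC|)%N = (#|T| ^ k)%N.
Proof.
have fib chi1 chi2 : chi1 \in pffun_on 1 (mem LC) predT -> chi2 \in pffun_on 1 (mem LC) predT ->
    #|[set x | charges x == chi1]| <= #|[set x | charges x == chi2]|.
  move=> /charges_surj[x1 e1] /charges_surj[x2 e2].
  pose tr (x : {ffun 'I_k -> T}) := [ffun p => x p * ((x1 p)^-1 * x2 p)].
  have tr_inj : injective tr.
    move=> x x' /ffunP e; apply/ffunP => p; have := e p; rewrite !ffunE.
    exact: mulIg.
  rewrite -(card_imset _ tr_inj); apply/subset_leq_card/subsetP => _ /imsetP[x + ->].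
  rewrite !inE => /eqP ex; apply/eqP/ffunP => C.
  have := congr1 (fun f : {ffun {set 'I_n} -> T} => f C) ex.
  have := congr1 (fun f : {ffun {set 'I_n} -> T} => f C) e1.
  have := congr1 (fun f : {ffun {set 'I_n} -> T} => f C) e2.
  rewrite !ffunE; case: ifP => // _ <- <- e.
  rewrite (eq_charge (x' := fun p => x p * ((x1 p)^-1 * x2 p))); last by move=> p; rewrite ffunE.
  rewrite 2!chargeM e mulgA -chargeM (eq_charge (x' := fun=> 1)) ?charge_ffun1 ?mul1g //.
  by move=> p; rewrite mulgV.
move=> chiP.
rewrite -[X in (_ * X)%N](card_pffun_on 1 (mem LC) predT) mulnC -sum_nat_const.
rewrite -[k in RHS]card_ord -card_ffun -cardsT -[RHS]sum1_card.
rewrite [RHS](partition_big charges (mem (pffun_on 1 (mem LC) predT))) /=; last first.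
  move=> x _; apply/pfamilyP; split => //; apply/supportP => C CL.
  by rewrite ffunE; case: ifP => // h; rewrite h in CL.
apply: eq_bigr => chi' chi'P; rewrite sum1dep_card.
have -> : #|[set x | (x \in [set: {ffun 'I_k -> T}]) && (charges x == chi')]|
          = #|[set x | charges x == chi']|.
  by apply: eq_card => x; rewrite !inE.
by apply/eqP; rewrite eqn_leq !fib.
Qed.

End Word.
End Charges.

(** * Multinomial coefficients *)

Section Multinomial.
Variables (I J T : finType) (c : I -> J) (t0 : T).
Implicit Types (A : {set I}) (a : J -> T -> nat) (chi : {ffun I -> T}).

Definition ncolour A (chi : {ffun I -> T}) j x := #|[set i in A | (c i == j) && (chi i == x)]|.

(** Outside [A] the value is pinned to [t0], so that labellings of [A] are
    counted once each. *)
Definition colourings A a : {set {ffun I -> T}} :=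
  [set chi : {ffun I -> T} | [forall i, (i \notin A) ==> (chi i == t0)]
             && [forall j, forall x, ncolour A chi j x == a j x]].

Lemma colouringsP A a chi : reflect
  ((forall i, i \notin A -> chi i = t0) /\ forall j x, ncolour A chi j x = a j x)
  (chi \in colourings A a).
Proof.
rewrite inE; apply: (iffP andP) => -[h1 h2]; split.
- by move=> i iA; have /forallP/(_ i) := h1; rewrite iA => /eqP.
- by move=> j x; have /forallP/(_ j)/forallP/(_ x)/eqP := h2.
- by apply/forallP => i; apply/implyP => iA; rewrite h1.
- by apply/forallP => j; apply/forallP => x; rewrite h2.
Qed.

(** Restores a label at a point that was taken out of [A]. *)
Definition paint i0 x (chi : {ffun I -> T}) : {ffun I -> T} := [ffun i => if i == i0 then x else chi i].

Lemma ncolour_paint A i0 x chi j y : i0 \in A ->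
  ncolour A (paint i0 x chi) j y = ((c i0 == j) && (x == y)) + ncolour (A :\ i0) chi j y.
Proof.
move=> i0A; rewrite /ncolour (cardsD1 i0) !inE i0A ffunE eqxx; congr (_ + _).
apply: eq_card => i; rewrite !inE ffunE.
by case: eqP.
Qed.

Definition lower a j0 x j y := a j y - ((j0 == j) && (x == y)).

Lemma card_colourings_paint A a i0 x : i0 \in A -> 0 < a (c i0) x ->
  #|[set chi in colourings A a | chi i0 == x]| = #|colourings (A :\ i0) (lower a (c i0) x)|.
Proof.
move=> i0A a0; have paint_inj : {in colourings (A :\ i0) (lower a (c i0) x) &, injective (paint i0 x)}.
  move=> f g /colouringsP[f0 _] /colouringsP[g0 _] /ffunP e; apply/ffunP => i.
  by have := e i; rewrite !ffunE; case: eqP => // -> _; rewrite f0 ?g0 // !inE eqxx.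
rewrite -(card_in_imset paint_inj); apply: eq_card => chi; apply/idP/imsetP.
  rewrite inE => /andP[/colouringsP[out cnt] /eqP chi0].
  have chiE : chi = paint i0 x (paint i0 t0 chi).
    by apply/ffunP => i; rewrite !ffunE; case: eqP => // ->.
  exists (paint i0 t0 chi) => //; apply/colouringsP; split.
    move=> i; rewrite !inE negb_and negbK ffunE; case: eqP => //= _; exact: out.
  by move=> j y; have := cnt j y; rewrite {1}chiE ncolour_paint // /lower => <-; rewrite addKn.
move=> [f /colouringsP[out cnt] ->]; rewrite inE ffunE !eqxx andbT; apply/colouringsP; split.
  move=> i iA; rewrite ffunE; case: eqP => [e|_]; first by rewrite e i0A in iA.
  by apply: out; rewrite !inE (negPf iA) andbF.
move=> j y; rewrite ncolour_paint // cnt /lower subnKC //.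
by case: eqP => //= <-; case: eqP => //= <-.
Qed.

Lemma prod_fact_lower a j0 x : 0 < a j0 x ->
  \prod_j \prod_y (a j y)`! = a j0 x * \prod_j \prod_y (lower a j0 x j y)`!.
Proof.
move=> a0; rewrite (bigD1 j0) //= [in RHS](bigD1 j0) //= mulnA.
congr (_ * _); last first.
  apply: eq_bigr => j /negPf nj; apply: eq_bigr => y _.
  by rewrite /lower eq_sym nj subn0.
rewrite (bigD1 x) //= [in RHS](bigD1 x) //= mulnA.
congr (_ * _); last first.
  by apply: eq_bigr => y /negPf ny; rewrite /lower [x == y]eq_sym ny andbF subn0.
by rewrite /lower !eqxx; case: (a j0 x) a0 => // m _; rewrite factS subn1.
Qed.

(** Induction on the size of [A], taking out a point [i0].  If its label is [x],
    the multiplicity of [x] among the points of the colour of [i0] drops by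
    one, which contributes the factor a j0 x to the product of factorials; these
    factors add up to the number of points of that colour. *)
Lemma card_colourings A a :
  (forall j, \sum_x a j x = #|[set i in A | c i == j]|) ->
  #|colourings A a| * \prod_j \prod_x (a j x)`! = \prod_j (#|[set i in A | c i == j]|)`!.
Proof.
elim: {A}#|A| {-2}A (erefl #|A|) a => [|m IHm] A cA a sum_a.
  have A0 : A = set0 by apply/eqP; rewrite -cards_eq0 cA.
  have m0 j : #|[set i in A | c i == j]| = 0.
    by apply: eq_card0 => i; rewrite A0 !inE.
  have a0 j x : a j x = 0.
    by have := sum_a j; rewrite m0 => /eqP; rewrite sum_nat_eq0 => /forallP/(_ x)/eqP.
  rewrite [RHS]big1 => [|j _]; last by rewrite m0.
  rewrite [X in _ * X]big1 ?muln1 => [|j _]; last by rewrite big1 // => x _; rewrite a0.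
  rewrite (_ : colourings A a = [set [ffun=> t0]]) ?cards1 //.
  apply/setP => chi; rewrite [RHS]inE; apply/colouringsP/eqP => [[out _]|->].
    by apply/ffunP => i; rewrite ffunE out // A0 inE.
  split=> [i _|j x]; first by rewrite ffunE.
  by rewrite a0; apply: eq_card0 => i; rewrite A0 !inE.
have [i0 i0A] : {i0 | i0 \in A} by apply/sigW/set0Pn; rewrite -card_gt0 cA.
pose j0 := c i0.
have card_j j : #|[set i in A | c i == j]| = (j0 == j) + #|[set i in A :\ i0 | c i == j]|.
  rewrite (cardsD1 i0) !inE i0A; congr (_ + _); apply: eq_card => i; rewrite !inE.
  by rewrite andbA.
have split_x : #|colourings A a| = \sum_(x | 0 < a j0 x) #|colourings (A :\ i0) (lower a j0 x)|.
  rewrite -sum1_card (partition_big (fun chi => chi i0) (fun x => 0 < a j0 x)) /=; last first.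
    move=> chi /colouringsP[_ <-]; rewrite card_gt0; apply/set0Pn; exists i0.
    by rewrite !inE !eqxx !andbT; exact: i0A.
    by apply: eq_bigr => x ax; rewrite sum1dep_card card_colourings_paint.
rewrite split_x big_distrl /=.
rewrite (eq_bigr (fun x => a j0 x * \prod_j (#|[set i in A :\ i0 | c i == j]|)`!)); last first.
  move=> x ax; rewrite (prod_fact_lower ax) mulnCA; congr (_ * _); apply: IHm.
    by apply/eqP; rewrite -eqSS -cA (cardsD1 i0 A) i0A.
  move=> j; apply/eqP; rewrite -(eqn_add2l (j0 == j)) -card_j -sum_a; apply/eqP.
  case: (eqVneq j0 j) => [<-|nj]; last first.
    by apply: eq_bigr => y _; rewrite /lower (negPf nj) subn0.
  rewrite (bigD1 x) //= [in RHS](bigD1 x) //= addnA /lower !eqxx /= subnKC //.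
  by congr (_ + _); apply: eq_bigr => y /negPf ny; rewrite [x == y]eq_sym ny subn0.
rewrite -big_distrl /=.
have -> : \sum_(x | 0 < a j0 x) a j0 x = #|[set i in A | c i == j0]|.
  rewrite -sum_a [RHS](bigID (fun x => 0 < a j0 x)) /= [X in _ + X]big1 ?addn0 // => x.
  by rewrite lt0n negbK => /eqP.
rewrite (bigD1 j0) //= [in RHS](bigD1 j0) //= mulnA card_j eqxx add1n factS.
congr (_ * _); apply: eq_bigr => j /negPf nj.
by rewrite card_j eq_sym nj.
Qed.

End Multinomial.

(** * Conjugacy in the wreath product *)

Lemma perm_eq_matching (A : finType) (K : eqType) (P Q : {set A}) (f g : A -> K) :
  (forall v, #|[set a in P | f a == v]| = #|[set a in Q | g a == v]|) ->
  exists phi : A -> A, [/\ {in P &, injective phi}, {in P, forall a, phi a \in Q}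
                       & {in P, forall a, g (phi a) = f a}].
Proof.
move=> cnt; case: (set_0Vmem P) => [->|[a0 a0P]].
  by exists id; split=> // a; rewrite inE.
have pe : perm_eq (map f (enum P)) (map g (enum Q)).
  have cE (B : {set A}) (h : A -> K) v : count_mem v (map h (enum B)) = #|[set a in B | h a == v]|.
    rewrite count_map cardE /enum_mem -size_filter -filter_predI; congr size.
    by apply: eq_filter => a; rewrite /= !inE andbC.
  by apply/allP => v _ /=; rewrite !cE cnt.
have [Is IsP fE] := perm_iotaP (f a0) pe.
have sz : size (enum P) = size (enum Q) by rewrite -(size_map f) (perm_size pe) size_map.
have szI : size Is = size (enum P) by rewrite (perm_size IsP) size_iota size_map sz.
have uI : uniq Is by rewrite (perm_uniq IsP) iota_uniq.
pose ix a := index a (enum P).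
have ixP a : a \in P -> ix a < size Is.
  by move=> aP; rewrite szI index_mem mem_enum.
have IsL i : i < size Is -> nth 0 Is i < size (enum Q).
  by move=> lt; have := mem_nth 0 lt; rewrite (perm_mem IsP) mem_iota size_map.
exists (fun a => nth a0 (enum Q) (nth 0 Is (ix a))); split.
- move=> a b aP bP /eqP; rewrite nth_uniq ?enum_uniq ?IsL ?ixP // nth_uniq ?ixP // => /eqP e.
  by rewrite -[a](nth_index a0 (s := enum P)) ?mem_enum // -/(ix a) e nth_index ?mem_enum.
- by move=> a aP; rewrite -mem_enum mem_nth // IsL ?ixP.
move=> a aP; have := congr1 (fun s => nth (f a0) s (ix a)) fE.
rewrite (nth_map a0) -?szI ?ixP // nth_index ?mem_enum // => ->.
by rewrite (nth_map 0) ?ixP // (nth_map a0) ?IsL ?ixP.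
Qed.

Lemma iter_porbit_inj (X : finType) (s : {perm X}) (r : X) a b :
  a < #|porbit s r| -> b < #|porbit s r| -> iter a s r = iter b s r -> a = b.
Proof.
move=> la lb e; apply/eqP.
rewrite -(nth_uniq r (s := traject s r #|porbit s r|)) ?size_traject ?uniq_traject_porbit //.
by rewrite !nth_traject // e.
Qed.

Section Conjugacy.
Local Open Scope group_scope.
Variables (T : finGroupType) (abelT : abelian [set: T]).
#[local] HB.instance Definition _ :=
  SemiGroup.isCommutativeLaw.Build T (@mulg T) (abel_mulC abelT).

Lemma prod_porbit (X : finType) (s : {perm X}) (r : X) (F : X -> T) :
  \prod_(q < #|porbit s r|) F (iter q.+1 s r) = \prod_(i in porbit s r) F i.
Proof.
rewrite [RHS](reindex_inj (@perm_inj _ s)) /=.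
rewrite (eq_bigl (mem (porbit s r))) => [|i]; last first.
  by rewrite /= -!eq_porbit_mem; have := porbit_perm s 1 i; rewrite expg1 => ->.
rewrite -[RHS]big_enum (perm_big (traject s r #|porbit s r|)) /=; last first.
  apply: uniq_perm; rewrite ?enum_uniq ?uniq_traject_porbit // => i.
  by rewrite mem_enum -porbit_traject.
rewrite (big_nth r) size_traject big_mkord; apply: eq_bigr => q _.
by rewrite nth_traject //= iterS.
Qed.

(** Match the cycles of [g] with those of [h] that have the same length and the
    same charge, choose a starting point on each cycle, and send the m-th point
    of a cycle to the m-th point of its partner.  The entries of the conjugating
    element are then determined along each cycle, starting from 1, and they
    close up because the charges agree. *)
Lemma wreath_conj n (g h : wreath T n) :
  (forall x p, nxpcycle g x p = nxpcycle h x p) -> exists u, u * g = h * u.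
Proof.
move=> nxp; set pg := wperm g; set ph := wperm h.
have [phi [phi_inj phiP phi_key]] : exists phi : {set 'I_n} -> {set 'I_n},
    [/\ {in porbits pg &, injective phi}, {in porbits pg, forall C, phi C \in porbits ph}
    & {in porbits pg, forall C, (#|phi C|, \prod_(i in phi C) wbase h i)
                               = (#|C|, \prod_(i in C) wbase g i)}].
  apply: (@perm_eq_matching _ _ (porbits pg) (porbits ph)
    (fun C => (#|C|, \prod_(i in C) wbase g i))
    (fun C => (#|C|, \prod_(i in C) wbase h i))) => -[p x]; rewrite /nxpcycle in nxp.
  have := nxp x p; congr (_ = _); apply: eq_card => C; rewrite !inE /is_xpcycle; congr (_ && _).
pose O i := porbit pg i.
have OP i : O i \in porbits pg by exact: imset_f.
pose r i := odflt i [pick j in O i].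
pose r' i := odflt i [pick j in phi (O i)].
have rO i : r i \in O i.
  by rewrite /r; case: pickP => //= _; exact: porbit_id.
have Or i : porbit pg (r i) = O i by apply/eqP; rewrite eq_porbit_mem.
have r'E i : phi (O i) = porbit ph (r' i).
  have /imsetP[j _ e] := phiP _ (OP i).
  rewrite /r'; case: pickP => [j' /=|/(_ j)]; last by rewrite /= e porbit_id.
  by rewrite e -eq_porbit_mem => /eqP.
have card_r i : #|porbit ph (r' i)| = #|O i|.
  by rewrite -r'E; case: (phi_key _ (OP i)).
have O_step i : O (pg i) = O i by have := porbit_perm pg 1 i; rewrite expg1.
have eq_r i j : O i = O j -> r i = r j.
  move=> e; rewrite /r e; case: pickP => // /(_ j); by rewrite /= porbit_id.
have eq_r' i j : O i = O j -> r' i = r' j.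
  move=> e; rewrite /r' e; case: pickP => //.
  have := porbit_id ph (r' j); rewrite -r'E => h1 /(_ (r' j)); by rewrite /= h1.
(* The place of [i] on its cycle, counted from the starting point. *)
pose m i := index i (traject pg (r i) #|O i|).
have m_lt i : m i < #|O i|.
  rewrite -[X in _ < X](size_traject pg (r i)) index_mem -Or -porbit_traject Or.
  exact: porbit_id.
have mE i : iter (m i) pg (r i) = i.
  rewrite -(nth_traject pg (m_lt i)) nth_index //.
  by rewrite -index_mem size_traject m_lt.
have m_uniq i a : a < #|O i| -> iter a pg (r i) = i -> m i = a.
  move=> la e; apply: (@iter_porbit_inj _ pg (r i)); rewrite ?Or ?m_lt //.
  by rewrite mE e.
pose s_ i := iter (m i) ph (r' i).
have m_step i : (m (pg i) = (m i).+1 /\ (m i).+1 < #|O i|) \/ (m (pg i) = 0 /\ (m i).+1 = #|O i|).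
  have := m_lt i; rewrite leq_eqVlt => /orP[/eqP e|lt]; [right|left]; split=> //.
    apply: m_uniq; first by rewrite O_step -e.
    rewrite /= (eq_r _ _ (O_step i)) -{2}(mE i) -iterS e -Or.
    by rewrite iter_porbit.
  by apply: m_uniq; rewrite ?O_step // iterS (eq_r _ _ (O_step i)) mE.
have s_step i : s_ (pg i) = ph (s_ i).
  rewrite /s_ (eq_r' _ _ (O_step i)) -iterS.
  by case: (m_step i) => [[-> _ //]|[-> ->]]; rewrite -card_r iter_porbit.
have s_inj : injective s_.
  move=> i j e; have sO k : s_ k \in phi (O k).
    rewrite r'E /s_; elim: (m k) => [|a IHa]; first exact: porbit_id.
    rewrite iterS -eq_porbit_mem; have := porbit_perm ph 1 (iter a ph (r' k)).
    by rewrite expg1 => ->; rewrite eq_porbit_mem.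
  have eO : O i = O j.
    apply: phi_inj => //; have := sO i; have := sO j; rewrite e !r'E -!eq_porbit_mem.
    by move=> /eqP <- /eqP <-.
  rewrite -(mE i) -(mE j) (eq_r _ _ eO); congr (iter _ pg (r j)).
  apply: (@iter_porbit_inj _ ph (r' j)); rewrite ?card_r ?m_lt -?eO ?m_lt //.
  by rewrite -{1}(eq_r' _ _ eO).
pose s := perm s_inj.
(* What the q-th step along the cycle of [i] contributes to the entry. *)
pose ratio i q := wbase h (iter q.+1 ph (r' i)) * (wbase g (iter q.+1 pg (r i)))^-1.
pose tau i := \prod_(q < m i) ratio i q.
have ratio1 i : \prod_(q < #|O i|) ratio i q = 1.
  rewrite /ratio big_split /=.
  have := phi_key _ (OP i) => -[_]; rewrite r'E -prod_porbit card_r => ->.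
  rewrite -Or -prod_porbit -big_split big1 // => q _ /=; exact: mulgV.
have eq_ratio i j : O i = O j -> ratio i =1 ratio j.
  by move=> e q; rewrite /ratio (eq_r _ _ e) (eq_r' _ _ e).
have tau_step i : tau (pg i) = wbase h (s_ (pg i)) * (wbase g (pg i))^-1 * tau i.
  have -> : wbase h (s_ (pg i)) * (wbase g (pg i))^-1 = ratio i (m i).
    by rewrite /ratio !iterS mE s_step.
  rewrite (abel_mulC abelT) /tau; under eq_bigr => q _ do rewrite (eq_ratio _ _ (O_step i)).
  rewrite -(big_ord_recr (m i) (fun q => ratio i q)) /=.
  case: (m_step i) => [[-> _ //]|[-> ->]].
  by rewrite big_ord0 ratio1.
exists (Wreath [ffun j => tau (s^-1 j)] s).
apply: wreath_eq; last first.
  by rewrite !wpermM /=; apply/permP => i; rewrite !permM !permE s_step.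
move=> j; rewrite !wbaseM /= !ffunE.
have [i ->] : exists i, j = s (pg i) by exists (pg^-1 (s^-1 j)); rewrite !permKV.
rewrite permK.
have -> : (wperm h)^-1 (s (pg i)) = s i.
  by rewrite [s (pg i)]permE s_step permK [s i]permE.
by rewrite permK tau_step permE -mulgA (abel_mulC abelT (tau i)) mulgA mulgKV.
Qed.

End Conjugacy.

(** * Cycles and the inclusion *)

Section Inclusion.
Local Open Scope group_scope.
Variables (T : finGroupType) (n : nat).
Notation star := (@ord_max n).

Lemma wbase_wincl_lift (h : wreath T n) i : wbase (wincl h) (lift star i) = wbase h i.
Proof. by rewrite /= ffunE liftK. Qed.

Lemma wbase_wincl_star (h : wreath T n) : wbase (wincl h) star = 1.
Proof. by rewrite /= ffunE unlift_none. Qed.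

Lemma wperm_wincl_lift (h : wreath T n) i : wperm (wincl h) (lift star i) = lift star (wperm h i).
Proof. by rewrite /= lift_perm_lift. Qed.

Lemma wperm_wincl_star (h : wreath T n) : wperm (wincl h) star = star.
Proof. by rewrite /= lift_perm_id. Qed.

Lemma winclP (g : wreath T n.+1) :
  reflect (exists h, g = wincl h) ((wperm g star == star) && (wbase g star == 1)).
Proof.
apply: (iffP andP) => [[/eqP gs /eqP g1]|[h ->]]; last by rewrite wperm_wincl_star wbase_wincl_star !eqxx.
have nstar i : star != wperm g (lift star i).
  by rewrite -[X in X != _]gs (inj_eq perm_inj) neq_lift.
have f_inj : injective (fun i => odflt i (unlift star (wperm g (lift star i)))).
  move=> i j; case: (unlift_some (nstar i)) => i' ei ->; case: (unlift_some (nstar j)) => j' ej -> /= e.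
  by apply/(@lift_inj _ star)/(@perm_inj _ (wperm g)); rewrite ei ej e.
exists (Wreath [ffun i => wbase g (lift star i)] (perm f_inj)).
apply: wreath_eq => [i|].
  case: (unliftP star i) => [j|] ->; last by rewrite wbase_wincl_star.
  by rewrite wbase_wincl_lift /= ffunE.
apply/permP => i; case: (unliftP star i) => [j|] ->; last by rewrite wperm_wincl_star.
rewrite wperm_wincl_lift permE; by case: (unlift_some (nstar j)) => j' ej ->.
Qed.

Lemma porbit_wincl (h : wreath T n) i :
  porbit (wperm (wincl h)) (lift star i) = lift star @: porbit (wperm h) i.
Proof.
have it m : (wperm (wincl h) ^+ m) (lift star i) = lift star ((wperm h ^+ m) i).
  elim: m => [|m IHm]; first by rewrite !expg0 !perm1.
  by rewrite !expgSr !permM IHm wperm_wincl_lift.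
apply/setP => j; apply/porbitP/imsetP => [[m ->]|[_ /porbitP[m ->] ->]].
  by exists ((wperm h ^+ m) i); [exact: mem_porbit|rewrite it].
by exists m; rewrite it.
Qed.

End Inclusion.

Section InclusionAb.
Local Open Scope group_scope.
Variables (T : finGroupType) (abelT : abelian [set: T]).
#[local] HB.instance Definition _ :=
  SemiGroup.isCommutativeLaw.Build T (@mulg T) (abel_mulC abelT).
Variable n : nat.
Notation star := (@ord_max n).

(** The inclusion adds one fixed point, with trivial entry. *)
Lemma nxpcycle_wincl (h : wreath T n) a p :
  nxpcycle (wincl h) a p = nxpcycle h a p + ((a == 1) && (p == 1%N)).
Proof.
rewrite /nxpcycle.
have lift_im_inj : injective (fun C : {set 'I_n} => lift star @: C).
  exact: imset_inj (@lift_inj _ star).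
have prodE (C : {set 'I_n}) : \prod_(i in lift star @: C) wbase (wincl h) i = \prod_(i in C) wbase h i.
  rewrite big_imset; last by move=> i j _ _; exact: lift_inj.
  by apply: eq_bigr => i _; rewrite wbase_wincl_lift.
have cardE (C : {set 'I_n}) : #|lift star @: C| = #|C| by rewrite card_imset //; exact: lift_inj.
rewrite -(card_imset _ lift_im_inj).
have -> : [set C | is_xpcycle (wincl h) a p C] =
    [set lift star @: C | C : {set 'I_n} in [set C | is_xpcycle h a p C]]
    :|: [set C in [set [set star]] | (a == 1) && (p == 1%N)].
  apply/setP => C; rewrite !inE; apply/and3P/orP => [[/imsetP[i _ ->] /eqP ep /eqP ea]|].
    case: (unliftP star i) ep ea => [j|] -> ep ea.
      left; rewrite porbit_wincl in ep ea *; rewrite imset_f // inE /is_xpcycle.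
      by rewrite -cardE ep -prodE ea !eqxx imset_f.
    have e1 := porbit1 (wperm_wincl_star h).
    by right; rewrite -ep -ea e1 cards1 big_set1 wbase_wincl_star !eqxx.
  move=> [/imsetP[D]|/and3P[/eqP -> /eqP -> /eqP ->]].
    rewrite inE => /and3P[/imsetP[i _ ->] /eqP <- /eqP <-] ->.
    by rewrite cardE prodE !eqxx -porbit_wincl imset_f.
  rewrite cards1 big_set1 wbase_wincl_star !eqxx; split=> //.
  by apply/imsetP; exists star; rewrite ?porbit1 // wperm_wincl_star.
rewrite cardsU disjoint_setI0 ?cards0 ?subn0.
  congr (_ + _); case: (_ && _); last by apply: eq_card0 => C; rewrite !inE andbF.
  by rewrite (_ : [set _ in _ | _] = [set [set star]]) ?cards1 //; apply/setP => C; rewrite !inE andbT.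
apply/pred0P => C /=; apply/negP => /andP[/imsetP[D _ ->]]; rewrite !inE => /andP[/eqP e _].
have : star \in lift star @: D by rewrite e inE.
by move=> /imsetP[i _ /eqP]; rewrite (negPf (neq_lift _ _)).
Qed.

End InclusionAb.

(** * Words of the Jucys-Murphy element *)

Section JMWords.
Local Open Scope group_scope.
Variables (T : finGroupType) (abelT : abelian [set: T]).
#[local] HB.instance Definition _ :=
  SemiGroup.isCommutativeLaw.Build T (@mulg T) (abel_mulC abelT).
Variables (n k : nat) (y : T).
Notation star := (@ord_max n).
Implicit Types (w : {ffun 'I_k -> 'I_n}) (x : {ffun 'I_k -> T}) (h : wreath T n).
Local Notation wordT := ({ffun 'I_k -> 'I_n} * {ffun 'I_k -> T})%type.
Implicit Types (wx : wordT).

Definition jmword (wx : wordT) : wreath T n.+1 :=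
  wword star (lword wx.1) wx.2 * wat y star.

(** Conjugation by an element of the smaller group changes the letter and the
    label of a factor, so it permutes the words. *)
Lemma wincl_step (u : wreath T n) a (t : T) :
  wincl u * wstep star (lift star a) t =
  wstep star (lift star (wperm u a)) (t * (wbase u (wperm u a))^-1) * wincl u.
Proof.
apply: wreath_eq => [i|]; last first.
  rewrite [LHS]wpermM [RHS]wpermM !wperm_step.
  have := tpermJ (lift star a) star (wperm (wincl u)).
  rewrite wperm_wincl_lift wperm_wincl_star conjgE => <-.
  by rewrite !mulgA mulgV mul1g.
rewrite [LHS]wbaseM [RHS]wbaseM !wbase_step ?(eq_sym _ star) ?neq_lift // wperm_step tpermV.
case: (unliftP star i) => [j|] ->; last first.
  have -> : (wperm (wincl u))^-1 star = star.
    by apply: (@perm_inj _ (wperm (wincl u))); rewrite permKV wperm_wincl_star.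
  rewrite wbase_wincl_star mul1g /sbase eqxx.
  by rewrite tpermR wbase_wincl_lift mulgKV.
rewrite wbase_wincl_lift.
have -> : (wperm (wincl u))^-1 (lift star j) = lift star ((wperm u)^-1 j).
  by apply: (@perm_inj _ (wperm (wincl u))); rewrite permKV wperm_wincl_lift permKV.
rewrite /sbase ![lift star _ == star]eq_sym !(negPf (neq_lift _ _)) !(inj_eq (@lift_inj _ star)).
rewrite (can2_eq (permKV _) (permK _)).
case: eqP => [->|/eqP nj].
  by rewrite tpermL wbase_wincl_star mulg1 invMg invgK.
rewrite tpermD ?wbase_wincl_lift ?mulg1 ?mul1g ?neq_lift //.
by rewrite (inj_eq (@lift_inj _ star)) eq_sym.
Qed.

Definition act_word (u : wreath T n) (wx : wordT) : wordT :=
  ([ffun p => wperm u (wx.1 p)],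
   [ffun p => wx.2 p * (wbase u (wperm u (wx.1 p)))^-1]).

Lemma act_word_inj u : injective (act_word u).
Proof.
move=> [w x] [w' x'] [/ffunP ew /ffunP ex].
have eqw : w = w' by apply/ffunP => p; have := ew p; rewrite !ffunE => /perm_inj.
congr pair => //; apply/ffunP => p; have := ex p; rewrite !ffunE /= eqw.
exact: mulIg.
Qed.

Lemma card_letters_act u wx : #|letters (lword (act_word u wx).1)| = #|letters (lword wx.1)|.
Proof.
have -> : letters (lword (act_word u wx).1) = wperm (wincl u) @: letters (lword wx.1).
  rewrite /letters -imset_comp; apply: eq_imset => p /=.
  by rewrite lift_perm_lift /lword ffunE.
by rewrite card_imset //; exact: perm_inj.
Qed.

Lemma wincl_wat (u : wreath T n) : wincl u * wat y star = wat y star * wincl u.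
Proof.
apply: wreath_eq => [i|]; last by rewrite !wpermM /= mulg1 mul1g.
rewrite !wbaseM /= !ffunE invg1 perm1.
case: (unliftP star i) => [j|] ->.
  rewrite [lift star j == star]eq_sym (negPf (neq_lift _ _)) mul1g.
  case: eqP => [e|]; last by rewrite mulg1.
  have /eqP := congr1 (lift_perm star star (wperm u)) e.
  by rewrite permKV lift_perm_id eq_sym (negPf (neq_lift _ _)).
have -> : (lift_perm star star (wperm u))^-1 star = star.
  by apply: (@perm_inj _ (lift_perm star star (wperm u))); rewrite permKV lift_perm_id.
by rewrite eqxx mul1g mulg1.
Qed.

Lemma wincl_wword (u : wreath T n) (wx : wordT) :
  wincl u * wword star (lword wx.1) wx.2 = wword star (lword (act_word u wx).1) (act_word u wx).2 * wincl u.
Proof.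
rewrite /wword /lword /=.
under [in RHS]eq_bigr => p _ do rewrite !ffunE.
elim: (index_enum _) => [|p s IHs]; first by rewrite !big_nil mulg1 mul1g.
by rewrite !big_cons mulgA wincl_step -mulgA IHs mulgA.
Qed.

Lemma wincl_jmword (u : wreath T n) (wx : wordT) : wincl u * jmword wx = jmword (act_word u wx) * wincl u.
Proof. by rewrite /jmword mulgA wincl_wword -mulgA wincl_wat mulgA. Qed.

Definition word_count h d :=
  #|[set wx | (jmword wx == wincl h) && (#|letters (lword wx.1)| == d)]|.

Lemma word_count_le (g h u : wreath T n) d : u * g = h * u -> word_count g d <= word_count h d.
Proof.
move=> e; rewrite /word_count -(card_imset _ (@act_word_inj u)).
apply/subset_leq_card/subsetP => _ /imsetP[wx + ->]; rewrite !inE => /andP[/eqP ew dw].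
rewrite card_letters_act dw andbT; apply/eqP/(mulIg (wincl u)).
by rewrite -wincl_jmword ew -!winclM e.
Qed.

(** The number of letters is kept by [act_word], and elements of the same type
    are conjugate. *)
Lemma word_count_class (rho : {ffun T -> young}) (g h : wreath T n) d :
  g \in tclass n rho -> h \in tclass n rho -> word_count g d = word_count h d.
Proof.
have nxpE g' h' : g' \in tclass n rho -> h' \in tclass n rho ->
    forall a p, nxpcycle g' a p = nxpcycle h' a p.
  rewrite !inE => /forallP gr /forallP hr a p.
  case: (ltnP p n.+1) => [lt|gt].
    have /forallP/(_ (Ordinal lt))/eqP -> := gr a.
    by have /forallP/(_ (Ordinal lt))/eqP -> := hr a.
  have z (g0 : wreath T n) : nxpcycle g0 a p = 0%N :> nat.
    apply: eq_card0 => C; rewrite inE; apply/negP => /and3P[_ /eqP Cp _].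
    move: gt; rewrite -Cp ltnNge => /negP[].
    by apply: leq_trans (max_card (mem C)) _; rewrite card_ord.
  by rewrite !z.
move=> gr hr.
have [u eu] := wreath_conj abelT (nxpE _ _ gr hr).
have [v ev] := wreath_conj abelT (nxpE _ _ hr gr).
by apply/eqP; rewrite eqn_leq (word_count_le _ eu) (word_count_le _ ev).
Qed.

Definition ncyc (wx : wordT) (a : T) (p : nat) : nat :=
  #|[set C in wcycles wx.1 | (#|C| == p) && (charge star (lword wx.1) wx.2 C == a)]|.

Lemma wbase_out wx i : i != star -> i \notin letters (lword wx.1) ->
  wbase (wword star (lword wx.1) wx.2) i = 1.
Proof.
move=> ns il; rewrite wbase_word; last exact: lword_star.
apply: big1 => p _.
have -> : (part star (lword wx.1) p)^-1 i = i.
  apply: (@perm_inj _ (part star (lword wx.1) p)); rewrite permKV part_fresh //.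
    exact: ltnW.
  by move=> r _; apply: contraNneq il => <-; exact: w_letters.
rewrite /sbase (negPf ns); case: eqP => // e.
by rewrite e w_letters in il.
Qed.

Lemma wbase_jmword wx i : wpi wx.1 star = star -> i != star ->
  wbase (jmword wx) i = wbase (wword star (lword wx.1) wx.2) i.
Proof.
move=> pis ns; rewrite /jmword wbaseM wperm_word /= ffunE.
case: eqP => [e|]; last by rewrite mulg1.
have := congr1 (wpi wx.1) e; rewrite permKV pis => e'.
by rewrite e' eqxx in ns.
Qed.

Lemma wperm_jmword wx : wperm (jmword wx) = wpi wx.1.
Proof. by rewrite /jmword wpermM wperm_word /= mul1g. Qed.

(** The cycles that are not made of letters are fixed points with trivial
    entry. *)
Lemma nxpcycle_jmword wx a p : wpi wx.1 star = star -> wbase (jmword wx) star = 1 ->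
  nxpcycle (jmword wx) a p =
    (ncyc wx a p + ((a == 1%g) && (p == 1%N)) * (n.+1 - #|letters (lword wx.1)|))%N.
Proof.
move=> pis b1; set L := letters _.
have Lstar : star \notin L by apply/negP => /lettersP[q e]; have := lword_star wx.1 q; rewrite -e eqxx.
have chE C : C \in wcycles wx.1 -> \prod_(i in C) wbase (jmword wx) i = charge star (lword wx.1) wx.2 C.
  move=> /imsetP[q _ ->]; apply: eq_bigr => i iq; apply: wbase_jmword => //.
  by apply: contraTneq iq => ->; apply: (star_cyc (@lword_star _ _ wx.1) pis).
have bout i : i \notin L -> wbase (jmword wx) i = 1.
  by move=> il; case: (eqVneq i star) => [->//|ns]; rewrite wbase_jmword ?wbase_out.
rewrite /nxpcycle /ncyc.
have -> : [set C | is_xpcycle (jmword wx) a p C] =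
   [set C in wcycles wx.1 | (#|C| == p) && (charge star (lword wx.1) wx.2 C == a)]
   :|: [set C in [set [set i] | i in ~: L] | (a == 1) && (p == 1%N)].
  apply/setP => C; rewrite !inE /is_xpcycle wperm_jmword (porbits_lcycles pis) inE.
  rewrite andb_orl; congr orb; first by apply: andb_id2l => CL; rewrite chE.
  apply: andb_id2l => /imsetP[i]; rewrite inE => il ->.
  by rewrite cards1 big_set1 bout // andbC ![1 == _]eq_sym ![1%N == _]eq_sym.
rewrite cardsU disjoint_setI0 ?cards0 ?subn0; last first.
  apply/pred0P => C /=; apply/negP => /andP[]; rewrite !inE.
  move=> /andP[/imsetP[q _ ->] _] /andP[/imsetP[i]]; rewrite inE => il e _.
  have : lword wx.1 q \in [set i] by rewrite -e; exact: porbit_id.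
  by rewrite inE => /eqP e'; rewrite -e' w_letters in il.
congr (_ + _)%N; case: (_ && _); last first.
  by rewrite mul0n; apply: eq_card0 => C; rewrite !inE andbF.
rewrite mul1n (_ : [set _ in _ | _] = [set [set i] | i in ~: L]); last first.
  by apply/setP => C; rewrite !inE andbT.
rewrite (card_imset _ set1_inj); have := cardsC L; rewrite [in RHS]card_ord.
by move: #|L| #|~: L| => c1 c2 <-; rewrite addKn.
Qed.

Lemma card_letters_le wx : #|letters (lword wx.1)| <= n.
Proof.
have card_im : #|lift star @: [set: 'I_n]| = n.
  by rewrite (card_imset _ (@lift_inj _ star)) cardsT card_ord.
apply: (@leq_trans #|lift star @: [set: 'I_n]|); last by rewrite card_im.
apply/subset_leq_card/subsetP => i /lettersP[p ->].
by rewrite /lword imset_f.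
Qed.

Lemma jmword_wincl wx h : jmword wx = wincl h -> wpi wx.1 star = star.
Proof. by move=> e; rewrite -wperm_jmword e wperm_wincl_star. Qed.

Lemma nxpcycle_word wx h a p : jmword wx = wincl h ->
  nxpcycle h a p = (ncyc wx a p + ((a == 1%g) && (p == 1%N)) * (n - #|letters (lword wx.1)|))%N.
Proof.
move=> e; have pis := jmword_wincl e.
have := nxpcycle_jmword a p pis; rewrite e wbase_wincl_star nxpcycle_wincl //.
move=> /(_ erefl); have := card_letters_le wx.
by case: (_ && _) => /=; move: (nxpcycle _ _ _) (ncyc _ _ _) #|_| => *; lia.
Qed.

(** The entries of a factor of the word have product 1, those of the last
    factor have product [y], and nontrivial entries are found only at letters
    and at the star. *)
Lemma prod_charge wx : wpi wx.1 star = star ->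
  (wbase (jmword wx) star)^-1 * y = \prod_(C in wcycles wx.1) charge star (lword wx.1) wx.2 C.
Proof.
move=> pis.
have tot : \prod_i wbase (wword star (lword wx.1) wx.2) i = 1.
  have := chargeE abelT (lword_star wx.1) wx.2 [set: 'I_n.+1].
  rewrite /charge => e.
  rewrite (eq_bigl (mem [set: 'I_n.+1])) => [|i]; last by rewrite /= inE.
  by rewrite e big1 // => p _; rewrite !inE mulgV.
have starb : wbase (jmword wx) star = wbase (wword star (lword wx.1) wx.2) star * y.
  rewrite /jmword wbaseM wperm_word /= ffunE.
  have -> : (starperm star (codom (lword wx.1)))^-1 star = star.
    by apply: (@perm_inj _ (wpi wx.1)); rewrite permKV.
  by rewrite eqxx.
rewrite /charge -big_trivIset; last exact: lcycles_trivI.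
rewrite (cover_lcycles pis) /=.
have Lstar : star \notin letters (lword wx.1).
  by apply/negP => /lettersP[q e]; have := lword_star wx.1 q; rewrite -e eqxx.
move: tot; rewrite (bigD1 star) //= (bigID (mem (letters (lword wx.1)))) /=.
rewrite [X in _ * (_ * X)]big1 ?mulg1 => [|i /andP[ns il]]; last exact: wbase_out.
rewrite (eq_bigl (mem (letters (lword wx.1)))) => [|i]; last first.
  by rewrite /= andbC; case: (boolP (_ \in _)) => //= il; apply: contraNneq Lstar => <-.
move=> /eqP; rewrite -eq_invg_mul => /eqP <-.
by rewrite starb invMg (abel_mulC abelT y^-1) mulgKV.
Qed.

End JMWords.

(** * Words with given shape and charges *)

Lemma nrow_gt_boxes (s : young) p : boxes s < p -> nrow p s = 0.
Proof.
move=> lt; apply/count_memPn; apply/negP => pr; move: lt.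
by rewrite /boxes sumnE (big_rem p) //= ltnNge leq_addr.
Qed.

Lemma nrow0 (s : young) : nrow 0 s = 0.
Proof. by apply/count_memPn; have /andP[] := rowsP s. Qed.

Lemma nrow_young_mult_gt (k : nat) (b : 'I_k -> nat) p : k < p -> nrow p (young_mult b) = 0.
Proof.
move=> kp; rewrite nrow_young_of ?(leq_ltn_trans _ kp) //.
rewrite count_flatten -map_comp sumnE big_map big1_seq // => j _ /=.
by rewrite count_nseq /= ltn_eqF // (leq_ltn_trans (ltn_ord j) kp).
Qed.

Section Families.
Variables (T : finGroupType) (k : nat) (y : T) (s : young).
Implicit Types (f : nfamily T k).

Lemma big_circ (R : Type) (idx : R) (op : Monoid.com_law idx) (F : T -> R) :
  \big[op/idx]_(a | a != 1%g) F a = \big[op/idx]_(x : circ T) F (val x).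
Proof.
rewrite (reindex_omap (val : circ T -> T) insub) => [|a an] /=.
  by apply: eq_bigl => x; rewrite valK eqxx (valP x).
by rewrite insubT.
Qed.

Lemma fam_ext_circ f (x : circ T) j : fam_ext s f (val x) j = f (x, j).
Proof. by rewrite /fam_ext valK. Qed.

Lemma fam_ext1 f j : fam_ext s f 1%g j = nrow j.+1 (strip s) - \sum_(x : circ T) f (x, j).
Proof. by rewrite /fam_ext insubF // eqxx. Qed.

Lemma sum_fam_ext f j : star_cond y s f -> \sum_a fam_ext s f a j = nrow j.+1 (strip s).
Proof.
move=> /and3P[_ /forallP/(_ j) le _]; rewrite (bigD1 1%g) //= big_circ fam_ext1.
have -> : \sum_(x : circ T) fam_ext s f (val x) j = \sum_(x : circ T) f (x, j).
  by apply: eq_bigr => x _; exact: fam_ext_circ.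
by rewrite subnK.
Qed.

Lemma nrow_tiota n m f a p : 0 < p ->
  nrow p (tiota n m (fam_type s f) a) =
  nrow p (fam_type s f a) + ((a == 1%g) && (p == 1)) * (n - m).
Proof.
move=> p0; rewrite ffunE; case: eqP => [->|] /=; last by rewrite addn0.
by rewrite nrow_young_of // count_cat count_nseq /= eq_sym.
Qed.

Lemma nrow_fam_type f a (j : 'I_k) : nrow j.+1 (fam_type s f a) = fam_ext s f a j.
Proof. by rewrite ffunE nrow_young_mult. Qed.

Lemma nrow_fam_type_gt f a p : k < p -> nrow p (fam_type s f a) = 0.
Proof. by move=> kp; rewrite ffunE nrow_young_mult_gt. Qed.

End Families.

Section Coloured.
Variables (T : finGroupType) (abelT : abelian [set: T]).
#[local] HB.instance Definition _ :=
  SemiGroup.isCommutativeLaw.Build T (@mulg T) (abel_mulC abelT).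
Variables (n k : nat) (y : T).
Hypothesis kn : k <= n.
Notation star := (@ord_max n).
Local Notation wordT := ({ffun 'I_k -> 'I_n} * {ffun 'I_k -> T})%type.
Implicit Types (wx : wordT) (h : wreath T n) (f : nfamily T k) (s : young).

(** The family n^x_i realized by a word; [inord] is harmless since there are at
    most [k] letter cycles. *)
Definition word_family wx : nfamily T k :=
  [ffun xj : circ T * 'I_k => inord (ncyc wx (val xj.1) xj.2.+1)].

Definition coloured s f : {set wordT} :=
  [set wx | (wx.1 \in planar_words k n s) &&
            [forall a : T, forall j : 'I_k, ncyc wx a j.+1 == fam_ext s f a j]].

Definition famclass s f : {set wreath T n} := tclass n (tiota n (boxes (strip s)) (fam_type s f)).

Lemma card_wcycles_le (w : {ffun 'I_k -> 'I_n}) : #|wcycles w| <= k.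
Proof. by rewrite -[k in _ <= k]card_ord; apply: leq_imset_card. Qed.

Lemma card_wletters_le (w : {ffun 'I_k -> 'I_n}) : #|letters (lword w)| <= k.
Proof. by rewrite -[k in _ <= k]card_ord; apply: leq_imset_card. Qed.

Lemma ncyc_le wx a p : ncyc wx a p <= k.
Proof.
apply: leq_trans (card_wcycles_le wx.1); apply/subset_leq_card/subsetP => C.
by rewrite inE => /andP[].
Qed.

Lemma word_familyE wx x j : word_family wx (x, j) = ncyc wx (val x) j.+1 :> nat.
Proof. by rewrite ffunE inordK // ltnS ncyc_le. Qed.

Lemma sum_ncyc wx p : \sum_a ncyc wx a p = #|[set C in wcycles wx.1 | #|C| == p]|.
Proof.
rewrite -sum1_card (partition_big (charge star (lword wx.1) wx.2) predT) //=.
apply: eq_bigr => a _; rewrite sum1dep_card; apply: eq_card => C.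
by rewrite !inE andbA.
Qed.

Lemma card_wcycle wx C : wpi wx.1 star = star -> C \in wcycles wx.1 -> 0 < #|C| <= k.
Proof.
move=> pis /imsetP[p _ ->]; apply/andP; split.
  by rewrite lt0n card_porbit_neq0.
apply: leq_trans (card_wletters_le wx.1); apply: subset_leq_card.
exact: (cyc_sub pis).
Qed.

Lemma ncyc_out wx a p : wpi wx.1 star = star -> ~~ (0 < p <= k) -> ncyc wx a p = 0.
Proof.
move=> pis np; apply: eq_card0 => C; rewrite inE; apply/negP => /and3P[CL /eqP Cp _].
by have := card_wcycle pis CL; rewrite Cp (negPf np).
Qed.

(** Besides the letter cycles, [h] has only fixed points with trivial entry.
    These are the rows added by [tiota], because the number of letters equals
    the size of the stripped diagram. *)
Lemma famclassP s f wx h : jmword y wx = wincl h ->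
  #|letters (lword wx.1)| = boxes (strip s) ->
  (h \in famclass s f) = [forall a : T, forall j : 'I_k, ncyc wx a j.+1 == fam_ext s f a j].
Proof.
move=> e d; have pis := jmword_wincl e.
have nx := nxpcycle_word abelT _ _ e; rewrite d in nx.
rewrite inE; apply/forallP/forallP => H a.
  apply/forallP => j; have lt : j.+1 < n.+1 by rewrite ltnS (leq_trans (ltn_ord j)).
  have /forallP/(_ (Ordinal lt)) := H a; rewrite nx nrow_tiota // nrow_fam_type.
  by rewrite eqn_add2r.
apply/forallP => -[[|p] pn] /=.
  rewrite nrow0 /nxpcycle; apply/eqP/eq_card0 => C; rewrite inE.
  apply/negP => /and3P[/imsetP[i _ ->] + _]; by rewrite (negPf (card_porbit_neq0 _ _)).
rewrite nx nrow_tiota // eqn_add2r; case: (ltnP p k) => pk.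
  by have /forallP/(_ (Ordinal pk)) := H a; rewrite -nrow_fam_type.
by rewrite nrow_fam_type_gt // ncyc_out // -ltnNge ltnS.
Qed.

Lemma count_cycle_sizes (w : {ffun 'I_k -> 'I_n}) p :
  count_mem p [seq #|C| | C : {set 'I_n.+1} in wcycles w] = #|[set C in wcycles w | #|C| == p]|.
Proof.
rewrite count_map cardE /enum_mem -size_filter -filter_predI; congr size.
by apply: eq_filter => C; rewrite /= !inE andbC.
Qed.

(** The type of [h] and the number of letters determine the lengths of the
    letter cycles, whence the shape and the genus. *)
Lemma colouredE s f wx h : s \in Ybar k -> star_cond y s f -> jmword y wx = wincl h ->
  (wx \in coloured s f) = (h \in famclass s f) && (#|letters (lword wx.1)| == k - nrows s).
Proof.
move=> sY sf e; have pis := jmword_wincl e.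
have bk : k - nrows s = boxes (strip s) by rewrite -[X in X - _](boxes_strip sY) addnK.
rewrite inE bk; apply/andP/andP => [[wP H]|[hc /eqP d]].
  move: wP; rewrite inE bk => /and3P[_ /eqP d _].
  by rewrite d eqxx (famclassP _ e d).
rewrite (famclassP _ e d) in hc; split=> //.
rewrite inE bk d eqxx pis eqxx /=; apply/allP => p _ /=; apply/eqP.
rewrite count_cycle_sizes -(sum_ncyc wx) -/(nrow p (strip s)).
case: (ltngtP 0 p) => // [p0|<-]; last first.
  by rewrite nrow0 big1 // => a _; rewrite ncyc_out.
case: (leqP p k) => pk.
  case: p p0 pk => // p _ pk; rewrite -(sum_fam_ext (Ordinal pk) sf).
  by apply: eq_bigr => a _; have /forallP/(_ a)/forallP/(_ (Ordinal pk))/eqP := hc.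
rewrite big1 => [|a _]; last by rewrite ncyc_out // [p <= k]leqNgt pk andbF.
by rewrite nrow_gt_boxes // (leq_ltn_trans _ pk) // -bk leq_subr.
Qed.

Lemma sum_ncyc_lengths wx a : wpi wx.1 star = star ->
  \sum_(j < k) ncyc wx a j.+1 =
  #|[set C in wcycles wx.1 | charge star (lword wx.1) wx.2 C == a]|.
Proof.
move=> pis; rewrite -sum1_card.
have -> : \sum_(j < k) ncyc wx a j.+1 = \sum_(j < k)
    \sum_(C in [set C in wcycles wx.1 | charge star (lword wx.1) wx.2 C == a]) (#|C| == j.+1).
  apply: eq_bigr => j _; rewrite -big_mkcondr sum1dep_card; apply: eq_card => C.
  by rewrite !inE -!andbA; congr andb; rewrite andbC.
rewrite exchange_big; apply: eq_bigr => C; rewrite inE => /andP[CL _].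
have /andP[C0 Ck] := card_wcycle pis CL.
have lt : #|C|.-1 < k by rewrite prednK.
rewrite (bigD1 (Ordinal lt)) //= prednK // eqxx big1 // => j nj.
apply/eqP; rewrite eqb0; apply: contraNneq nj => e.
by rewrite -val_eqE /= e.
Qed.

Lemma prod_charge_ncyc wx : wpi wx.1 star = star ->
  (\prod_(C in wcycles wx.1) charge star (lword wx.1) wx.2 C =
  \prod_(x : circ T) val x ^+ (\sum_(j < k) ncyc wx (val x) j.+1))%g.
Proof.
move=> pis; rewrite (partition_big (charge star (lword wx.1) wx.2) predT) //=.
rewrite (bigD1 1%g) //= [X in (X * _)%g]big1 ?mul1g => [|C /andP[_ /eqP] //].
rewrite big_circ; apply: eq_bigr => x _.
rewrite (eq_bigr (fun=> val x)) => [|C /andP[_ /eqP] //].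
rewrite sum_ncyc_lengths // big_const.
have -> : #|[pred C | (C \in wcycles wx.1) && (charge star (lword wx.1) wx.2 C == val x)]|
   = #|[set C in wcycles wx.1 | charge star (lword wx.1) wx.2 C == val x]|.
  by apply: eq_card => C; rewrite !inE.
by elim: #|_| => //= m ->; rewrite expgS.
Qed.

(** The last clause of [star_cond] says that the charges have product [y], and
    by [prod_charge] this is what makes the entry at the star trivial. *)
Lemma coloured_wincl s f wx : star_cond y s f -> wx \in coloured s f ->
  exists h, jmword y wx = wincl h.
Proof.
move=> sf; rewrite inE => /andP[+ /forallP H]; rewrite inE => /and3P[/eqP pis _ _].
apply/winclP; rewrite wperm_jmword pis eqxx /=.
have := prod_charge abelT y pis; rewrite (prod_charge_ncyc pis).
under eq_bigr => x _ do under eq_bigr => j _ do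
  rewrite (eqP (forallP (H (val x)) j)) fam_ext_circ.
have /and3P[_ _ /eqP ->] := sf.
by move=> /(canRL (mulgK y)); rewrite mulgV => /eqP; rewrite invg_eq1.
Qed.

Lemma word_family_star s wx h : s \in Ybar k -> wx.1 \in planar_words k n s ->
  jmword y wx = wincl h ->
  star_cond y s (word_family wx) /\ wx \in coloured s (word_family wx).
Proof.
move=> sY wP e; have pis := jmword_wincl e.
have sumE j : \sum_a ncyc wx a j.+1 = nrow j.+1 (strip s).
  move: wP; rewrite inE => /and3P[_ _ pe].
  by rewrite sum_ncyc -count_cycle_sizes (seq.permP pe).
have sum_circ (j : 'I_k) : ncyc wx 1%g j.+1 + \sum_(x : circ T) word_family wx (x, j) = nrow j.+1 (strip s).
  rewrite -sumE [RHS](bigD1 1%g) //= big_circ; congr (_ + _).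
  by apply: eq_bigr => x _; rewrite word_familyE.
have cond2 (j : 'I_k) : \sum_(x : circ T) word_family wx (x, j) <= nrow j.+1 (strip s).
  by rewrite -sum_circ leq_addl.
split; last first.
  rewrite inE wP; apply/forallP => a; apply/forallP => j; apply/eqP.
  case: (eqVneq a 1%g) => [->|an]; first by rewrite fam_ext1 -sum_circ addnK.
  by rewrite -[a]/(val (Sub a an : circ T)) fam_ext_circ word_familyE.
apply/and3P; split.
- apply/forallP => j; apply/forallP => x; apply: leq_trans (cond2 j).
  by rewrite (bigD1 x) //= leq_addr.
- by apply/forallP => j; exact: cond2.
have := prod_charge abelT y pis; rewrite (prod_charge_ncyc pis) e wbase_wincl_star invg1 mul1g.
move=> ->; apply/eqP; apply: eq_bigr => x _; congr (_ ^+ _)%g.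
by apply: eq_bigr => j _; rewrite word_familyE.
Qed.

Lemma word_family_uniq s f wx : wx \in coloured s f -> word_family wx = f.
Proof.
rewrite inE => /andP[_ /forallP H]; apply/ffunP => -[x j]; apply/val_inj => /=.
by rewrite word_familyE (eqP (forallP (H (val x)) j)) fam_ext_circ.
Qed.

Definition nwords (A : {set wordT}) h := #|[set wx in A | jmword y wx == wincl h]|.

Lemma nwords_planar s h : s \in Ybar k ->
  nwords [set wx | wx.1 \in planar_words k n s] h =
  \sum_(f | star_cond y s f) nwords (coloured s f) h.
Proof.
move=> sY; rewrite /nwords -sum1_card (partition_big word_family (star_cond y s)) /=; last first.
  move=> wx; rewrite inE => /andP[]; rewrite inE => wP /eqP e.
  by have [] := word_family_star sY wP e.
apply: eq_bigr => f sf; rewrite sum1dep_card; apply: eq_card => wx.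
rewrite inE [in RHS]inE; apply/andP/andP => [[]|[wc eh]].
  rewrite inE => /andP[]; rewrite inE => wP /[dup] eh /eqP e /eqP <-; split=> //.
  by have [] := word_family_star sY wP e.
rewrite (word_family_uniq wc) eqxx inE eh andbT; split=> //.
by move: wc; rewrite inE => /andP[wP _]; rewrite inE.
Qed.

Lemma nwords_coloured_out s f h : s \in Ybar k -> star_cond y s f ->
  h \notin famclass s f -> nwords (coloured s f) h = 0.
Proof.
move=> sY sf hn; apply: eq_card0 => wx; rewrite inE; apply/negP => /andP[wc /eqP e].
by rewrite (colouredE sY sf e) (negPf hn) in wc.
Qed.

Lemma nwords_coloured_class s f g h : s \in Ybar k -> star_cond y s f ->
  g \in famclass s f -> h \in famclass s f ->
  nwords (coloured s f) g = nwords (coloured s f) h.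
Proof.
move=> sY sf.
have nE h' : h' \in famclass s f -> nwords (coloured s f) h' = word_count k y h' (k - nrows s).
  move=> hc; apply: eq_card => wx; rewrite inE [RHS]inE andbC.
  by case: eqP => //= e; rewrite (colouredE sY sf e) hc.
by move=> gc hc; rewrite !nE // (word_count_class abelT k y (k - nrows s) gc hc).
Qed.

(** By [coloured_wincl] every such word gives an element of the smaller group,
    and by [nwords_coloured_out] this element lies in the class. *)
Lemma sum_nwords_coloured s f : s \in Ybar k -> star_cond y s f ->
  \sum_(h in famclass s f) nwords (coloured s f) h = #|coloured s f|.
Proof.
move=> sY sf.
have -> : \sum_(h in famclass s f) nwords (coloured s f) h = \sum_h nwords (coloured s f) h.
  rewrite [RHS](bigID (mem (famclass s f))) /= [X in _ + X]big1 ?addn0 // => h hn.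
  exact: nwords_coloured_out.
pose pre wx : wreath T n := odflt 1%g [pick h | jmword y wx == wincl h].
rewrite -[RHS]sum1_card (partition_big pre predT) //=; apply: eq_bigr => h _.
rewrite sum1dep_card; apply: eq_card => wx; rewrite inE [RHS]inE; apply: andb_id2l => wc.
have [h' e] := coloured_wincl sf wc.
rewrite /pre; case: pickP => [h'' /eqP e2|/(_ h')]; last by rewrite e eqxx.
by rewrite /= e2 (inj_eq (@wincl_inj _ _)) eq_sym.
Qed.

End Coloured.

(** * The number of words with given shape and charges *)

Section CardColoured.
Variables (T : finGroupType) (abelT : abelian [set: T]).
#[local] HB.instance Definition _ :=
  SemiGroup.isCommutativeLaw.Build T (@mulg T) (abel_mulC abelT).
Variables (n k : nat) (y : T) (s : young) (f : nfamily T k).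
Notation star := (@ord_max n).
Hypothesis sY : s \in Ybar k.
Hypothesis sf : star_cond y s f.

(** Cycle lengths are indexed by 0, ..., k, which is a nonempty range even for
    k = 0; no cycle has length 0. *)
Definition prescribed (j : 'I_k.+1) (a : T) : nat :=
  if unlift ord0 j is Some j' then fam_ext s f a j' else 0.

Lemma prod_lengths (F : 'I_k.+1 -> nat) : F ord0 = 1 ->
  \prod_(j < k.+1) F j = \prod_(j < k) F (lift ord0 j).
Proof. by move=> F0; rewrite big_ord_recl F0 mul1n. Qed.

Section Word.
Variable w : {ffun 'I_k -> 'I_n}.
Hypothesis wP : w \in planar_words k n s.

Let pis : wpi w star = star.
Proof. by move: wP; rewrite inE => /and3P[/eqP]. Qed.

Let sizes p : #|[set C in wcycles w | #|C| == p]| = nrow p (strip s).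
Proof.
by move: wP; rewrite inE => /and3P[_ _ pe]; rewrite -count_cycle_sizes (seq.permP pe).
Qed.

Definition cycle_length (C : {set 'I_n.+1}) : 'I_k.+1 := inord #|C|.

Let cycle_lengthE C (j : 'I_k.+1) : C \in wcycles w -> (cycle_length C == j) = (#|C| == j).
Proof.
move=> CL; have x0 : {ffun 'I_k -> T} by exact: [ffun=> 1%g].
have /andP[_ Ck] := card_wcycle (wx := (w, x0)) pis CL.
by rewrite -val_eqE /= inordK.
Qed.

Let card_length (j : 'I_k.+1) :
  #|[set C in wcycles w | cycle_length C == j]| = nrow j (strip s).
Proof.
rewrite -sizes; apply: eq_card => C; rewrite !inE; apply: andb_id2l => CL.
exact: cycle_lengthE.
Qed.

Definition labellings : {set {ffun 'I_k -> T}} :=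
  [set x | [forall a : T, forall j : 'I_k, ncyc (w, x) a j.+1 == fam_ext s f a j]].

Lemma ncolour_charges (x : {ffun 'I_k -> T}) (j : 'I_k) a :
  ncolour cycle_length (wcycles w) (charges star (lword w) x) (lift ord0 j) a =
  ncyc (w, x) a j.+1.
Proof.
apply: eq_card => C; rewrite !inE; apply: andb_id2l => CL.
by rewrite cycle_lengthE // lift0 ffunE CL.
Qed.

Lemma ncolour_charges0 (x : {ffun 'I_k -> T}) a :
  ncolour cycle_length (wcycles w) (charges star (lword w) x) ord0 a = 0.
Proof.
apply: eq_card0 => C; rewrite !inE; apply/negP => /and3P[CL + _].
have /andP[C0 _] := card_wcycle (wx := (w, x)) pis CL.
by rewrite cycle_lengthE // -leqn0 leqNgt C0.
Qed.

Lemma labellingsE x : (x \in labellings) =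
  (charges star (lword w) x \in colourings cycle_length 1%g (wcycles w) prescribed).
Proof.
rewrite inE; apply/forallP/colouringsP => [H|[_ H] a].
  split=> [C CL|j a]; first by rewrite ffunE (negPf CL).
  rewrite /prescribed; case: unliftP => [j'|] ->; last exact: ncolour_charges0.
  by rewrite ncolour_charges; have /forallP/(_ j')/eqP := H a.
by apply/forallP => j; rewrite -ncolour_charges H /prescribed liftK.
Qed.

(** Each family of charges with the prescribed multiplicities comes from the
    same number of label sequences. *)
Lemma card_labellings :
  #|labellings| * #|T| ^ nrows s * \prod_(j < k) \prod_a (fam_ext s f a j)`! =
  #|T| ^ k * \prod_(j < k) (nrow j.+1 (strip s))`!.
Proof.
have c0 : #|wcycles w| = nrows s.
  move: wP; rewrite inE => /and3P[_ _ pe].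
  by rewrite -(size_strip sY) -(perm_size pe) size_map cardE.
set Col := colourings cycle_length 1%g (wcycles w) prescribed.
have -> : #|labellings| * #|T| ^ nrows s = #|Col| * #|T| ^ k.
  rewrite -sum1_card (partition_big (charges star (lword w)) (mem Col)) /=; last first.
    by move=> x; rewrite labellingsE.
  rewrite big_distrl -sum_nat_const; apply: eq_bigr => chi chiC.
  have [out _] := colouringsP _ _ _ _ _ chiC.
  rewrite sum1dep_card -c0 -(card_charges abelT (lword_star w) pis (chi := chi)).
    congr (_ * _); apply: eq_card => x; rewrite [RHS]inE inE labellingsE.
    by case: eqP => [->|_]; rewrite ?andbF // chiC.
  by apply/pfamilyP; split=> //; apply/supportP => C CL; exact: out.
have := @card_colourings _ _ _ cycle_length 1%g (wcycles w) prescribed.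
rewrite -/Col !prod_lengths.
- have -> : \prod_(j < k) \prod_a (prescribed (lift ord0 j) a)`! = \prod_(j < k) \prod_a (fam_ext s f a j)`!.
    by apply: eq_bigr => j _; apply: eq_bigr => a _; rewrite /prescribed liftK.
  have -> : \prod_(j < k) #|[set C in wcycles w | cycle_length C == lift ord0 j]|`! =
            \prod_(j < k) (nrow j.+1 (strip s))`!.
    by apply: eq_bigr => j _; rewrite card_length lift0.
  move=> <-; first by rewrite mulnAC mulnC.
  move=> j; rewrite card_length /prescribed; case: unliftP => [j'|] ->.
    by rewrite lift0 (sum_fam_ext _ sf).
  by rewrite nrow0 big1.
- by rewrite card_length nrow0.
by rewrite big1 // => a _; rewrite /prescribed unlift_none.
Qed.

End Word.

Lemma card_coloured :
  #|coloured n s f| * #|T| ^ nrows s * \prod_(j < k) \prod_a (fam_ext s f a j)`! =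
  #|NC k s| * n ^_ (k - nrows s) * #|T| ^ k * \prod_(j < k) (nrow j.+1 (strip s))`!.
Proof.
rewrite -(card_planar_words n sY) -!mulnA mulnA -[RHS]sum_nat_const.
have -> : #|coloured n s f| = \sum_(w in planar_words k n s) #|labellings w|.
  rewrite -sum1_card (partition_big fst (mem (planar_words k n s))) /=; last first.
    by move=> wx; rewrite inE => /andP[].
  apply: eq_bigr => w wP; rewrite sum1dep_card.
  have pair_inj : injective (fun x : {ffun 'I_k -> T} => (w, x)) by move=> x x' [].
  rewrite -(card_imset _ pair_inj); apply: eq_card => -[w' x]; rewrite inE.
  apply/andP/imsetP => [[+ /eqP /= e]|[x' x'l [-> ->]]].
    by rewrite e inE => /andP[_ H]; exists x; rewrite // inE.
  by rewrite eqxx inE wP; move: x'l; rewrite inE.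
rewrite !big_distrl /=; apply: eq_bigr => w wP; exact: card_labellings.
Qed.

End CardColoured.

(** * The remainder *)

Lemma young_of_perm (s t : seq nat) : perm_eq s t -> young_of s = young_of t.
Proof.
move=> st; apply: val_inj => /=; apply/perm_sortP; last exact: perm_filter.
- exact: (fun m n => leq_total n m).
- by move=> a b c /= ba ac; exact: leq_trans ac ba.
- by move=> a b /= /andP[ba ab]; apply/eqP; rewrite eqn_leq ab ba.
Qed.

Lemma perm_young_of (s : seq nat) : 0 \notin s -> perm_eq (young_of s) s.
Proof.
move=> s0; rewrite /= perm_sort (_ : [seq r <- s | 0 < r] = s) //.
by apply/all_filterP/allP => -[|r] //; rewrite (negPf s0).
Qed.

Section Shape.
Variables (k n : nat).
Notation star := (@ord_max n).
Implicit Types (w : {ffun 'I_k -> 'I_n}) (s : young).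

Definition sizes w := [seq #|C| | C : {set 'I_n.+1} in wcycles w].
(** The number g in [genus_word]. *)
Definition wgenus w := (k - #|letters (lword w)| - #|wcycles w|)./2.
(** A row of length 2 for each unit of genus makes the number of boxes equal to
    [k], and removing the first column turns it into a row of length 1. *)
Definition wshape w : young := young_of ([seq r.+1 | r <- sizes w] ++ nseq (wgenus w) 2).

Lemma genus_wgenus w : wpi w star = star ->
  k = #|letters (lword w)| + #|wcycles w| + (wgenus w).*2.
Proof.
move=> pis; have [g e] := genus_word (lword_star w) pis.
have -> : wgenus w = g; last by [].
by rewrite /wgenus /wcycles {1}e; move: #|_| #|_| => *; lia.
Qed.

Lemma perm_wshape w : perm_eq (wshape w) ([seq r.+1 | r <- sizes w] ++ nseq (wgenus w) 2).
Proof.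
apply: perm_young_of; rewrite mem_cat mem_nseq andbF orbF.
by apply/mapP => -[].
Qed.

Lemma sumn_sizes w : wpi w star = star -> sumn (sizes w) = #|letters (lword w)|.
Proof.
move=> pis; rewrite -(sum_lcycles pis) sumnE big_map big_enum_cond /=.
by apply: eq_bigl => C; rewrite andbT.
Qed.

Lemma size_sizes w : size (sizes w) = #|wcycles w|.
Proof. by rewrite size_map cardE. Qed.

Lemma wshape_Ybar w : wpi w star = star -> wshape w \in Ybar k.
Proof.
move=> pis; rewrite mem_Ybar /boxes /nrow (perm_sumn (perm_wshape w)) (seq.permP (perm_wshape w)).
rewrite count_cat count_nseq mul0n addn0 sumn_cat sumn_nseq.
have -> : sumn [seq r.+1 | r <- sizes w] = sumn (sizes w) + size (sizes w).
  by elim: (sizes w) => //= r t ->; lia.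
rewrite sumn_sizes // size_sizes; apply/andP; split.
  by apply/eqP; rewrite [RHS](genus_wgenus pis); lia.
rewrite count_map; apply/eqP/count_memPn; apply/negP => /mapP[C]; rewrite mem_enum.
by move=> /imsetP[p _ ->] /eqP; rewrite eq_sym (negPf (card_porbit_neq0 _ _)).
Qed.

Lemma nrows_wshape w : nrows (wshape w) = #|wcycles w| + wgenus w.
Proof. by rewrite /nrows (perm_size (perm_wshape w)) size_cat size_map size_nseq size_sizes. Qed.

Lemma letters_wshape w : wpi w star = star ->
  k - nrows (wshape w) = #|letters (lword w)| + wgenus w.
Proof.
move=> pis; rewrite nrows_wshape [in X in X - _](genus_wgenus pis).
by move: #|_| #|_| (wgenus w) => *; lia.
Qed.

Lemma perm_strip_wshape w : wpi w star = star ->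
  perm_eq (strip (wshape w)) (sizes w ++ nseq (wgenus w) 1).
Proof.
move=> pis; apply: (perm_map_inj succn_inj); apply: perm_trans (perm_strip (wshape_Ybar pis)) _.
by apply: perm_trans (perm_wshape w) _; rewrite map_cat map_nseq.
Qed.

Lemma planar_words_wshape s w : wpi w star = star -> s \in Ybar k ->
  (w \in planar_words k n s) = (wshape w == s) && (#|letters (lword w)| == k - nrows s).
Proof.
move=> pis sY; apply/idP/andP => [wP|[/eqP e /eqP d]].
  have planar := planar_words_genus sY wP.
  have g0 : wgenus w = 0.
    by have := genus_wgenus pis; rewrite [X in X = _]planar; move: #|_| #|_| (wgenus w) => *; lia.
  move: wP; rewrite inE => /and3P[_ -> pe]; split=> //.
  rewrite -[X in _ == X]young_of_rows /wshape g0 cats0; apply/eqP/young_of_perm.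
  by apply: perm_trans (perm_strip sY); exact: perm_map.
have := letters_wshape pis; rewrite e -d => /eqP.
rewrite -[X in X == _]addn0 eqn_add2l => /eqP g0.
rewrite inE pis eqxx d eqxx /=.
by have := perm_strip_wshape pis; rewrite -g0 cats0 e perm_sym.
Qed.

(** A word with at most [D] letters factors through a set of [D] elements. *)
Lemma card_few_letters D : 0 < k ->
  #|[set w : {ffun 'I_k -> 'I_n} | #|letters (lword w)| <= D]| <= D ^ k * n ^ D.
Proof.
move=> k0; pose p0 := Ordinal k0.
pose F (fl : {ffun 'I_k -> 'I_D} * {ffun 'I_D -> 'I_n}) : {ffun 'I_k -> 'I_n} :=
  [ffun p => fl.2 (fl.1 p)].
have -> : D ^ k * n ^ D = #|{: {ffun 'I_k -> 'I_D} * {ffun 'I_D -> 'I_n}}|.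
  by rewrite card_prod !card_ffun !card_ord.
rewrite -cardsT; apply: leq_trans (leq_imset_card F _).
apply/subset_leq_card/subsetP => w; rewrite inE => le.
pose L := [set w p | p : 'I_k].
have cL : #|L| <= D.
  apply: leq_trans le; rewrite (_ : letters (lword w) = lift star @: L).
    by rewrite (card_imset _ (@lift_inj _ star)).
  by rewrite /letters /L -imset_comp.
have lt p : index (w p) (enum L) < D.
  by apply: leq_trans cL; rewrite cardE index_mem mem_enum imset_f.
apply/imsetP; exists ([ffun p => Ordinal (lt p)], [ffun i : 'I_D => nth (w p0) (enum L) i]).
  by rewrite inE.
by apply/ffunP => p; rewrite !ffunE /= nth_index // mem_enum imset_f.
Qed.

End Shape.

Section Remainder.
Variables (T : finGroupType) (abelT : abelian [set: T]).
#[local] HB.instance Definition _ :=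
  SemiGroup.isCommutativeLaw.Build T (@mulg T) (abel_mulC abelT).
Variables (n k : nat) (y : T).
Notation star := (@ord_max n).
Local Notation wordT := ({ffun 'I_k -> 'I_n} * {ffun 'I_k -> T})%type.
Implicit Types (wx : wordT) (h : wreath T n) (s : young).

Lemma count_nontriv_lengths h p : count_mem p (nontriv_lengths h) =
  \sum_a (if (a == 1%g) && (p == 1) then 0 else nxpcycle h a p).
Proof.
rewrite count_map.
have -> : count [preim (fun C : {set 'I_n} => #|C|) of pred1 p]
     (enum [set C in porbits (wperm h) | ~~ is_xpcycle h 1%g 1 C]) =
   #|[set C in porbits (wperm h) | ~~ is_xpcycle h 1%g 1 C & #|C| == p]|.
  rewrite cardE /enum_mem -size_filter -filter_predI; congr size.
  by apply: eq_filter => C; rewrite /= !inE andbC andbA.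
rewrite -sum1_card (partition_big (fun C : {set 'I_n} => \prod_(i in C) wbase h i)%g predT) //=.
apply: eq_bigr => a _; rewrite sum1dep_card.
case: ifP => [/andP[/eqP -> /eqP ->]|ap].
  apply: eq_card0 => C; rewrite !inE /is_xpcycle; apply/negP.
  by move=> /andP[/and3P[CP nx c1] pr]; rewrite CP c1 pr in nx.
apply: eq_card => C; rewrite !inE /is_xpcycle -!andbA; apply: andb_id2l => CP; rewrite CP /=.
case: (#|C| =P p) => [->|_]; rewrite ?andbF //=.
case: (_ =P a) => [->|_]; rewrite ?andbF //=.
by rewrite andbT andbC ap.
Qed.

(** The missing rows of length 1 stand for the letters that are fixed points with
    trivial charge, and for the genus. *)
Lemma nontriv_type_wshape wx h : jmword y wx = wincl h ->
  nontriv_type (strip (wshape wx.1)) h.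
Proof.
move=> e; have pis := jmword_wincl e.
exists (ncyc wx 1%g 1 + wgenus wx.1).
rewrite perm_sym; apply: perm_trans (perm_strip_wshape pis) _.
apply/allP => p _; apply/eqP; rewrite /= !count_cat !count_nseq count_nontriv_lengths.
rewrite count_cycle_sizes -(sum_ncyc wx).
have nx := nxpcycle_word abelT _ _ e.
case: (eqVneq p 1) => [->|p1].
  rewrite !mul1n addnA; congr (_ + _).
  rewrite (bigD1 1%g) //= [in RHS](bigD1 1%g) //= eqxx /= add0n addnC; congr (_ + _).
  by apply: eq_bigr => a /negPf a1; rewrite a1 /= nx a1 addn0.
have -> : pred1 p 1 = false by rewrite /= eq_sym (negPf p1).
rewrite !mul0n !addn0; apply: eq_bigr => a _.
by rewrite nx (negPf p1) andbF addn0.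
Qed.

(** The words of shape [s] with positive genus, by [letters_wshape]. *)
Definition remainder_words s : {set wordT} :=
  [set wx | [&& [exists h, jmword y wx == wincl h], wshape wx.1 == s
             & #|letters (lword wx.1)| < k - nrows s]].

Definition remainder s : seq (wreath T n) :=
  pmap (fun wx => [pick h | jmword y wx == wincl h]) (enum (remainder_words s)).

Lemma pick_jmword wx h : ([pick h | jmword y wx == wincl h] == Some h) = (jmword y wx == wincl h).
Proof.
case: pickP => [h' /eqP ->|/(_ h) ->] //.
by rewrite (inj_eq (@wincl_inj _ _)).
Qed.

Lemma remainderP s g : g \in remainder s ->
  exists2 wx, wx \in remainder_words s & jmword y wx = wincl g.
Proof.
rewrite mem_pmap => /mapP[wx].
by rewrite mem_enum => wxR /esym/eqP; rewrite pick_jmword => /eqP; exists wx.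
Qed.

Lemma remainder_nontriv s g : g \in remainder s -> nontriv_type (strip s) g.
Proof.
move=> /remainderP[wx]; rewrite inE => /and3P[_ /eqP <- _]; exact: nontriv_type_wshape.
Qed.

Lemma count_remainder s h : count_mem h (remainder s) = nwords y (remainder_words s) h.
Proof.
rewrite /nwords -sum1_card /remainder.
have -> : \sum_(wx in [set wx in remainder_words s | jmword y wx == wincl h]) 1 =
          \sum_(wx <- enum (remainder_words s)) (jmword y wx == wincl h).
  rewrite big_enum_cond /= [RHS]big_mkcond /= big_mkcond /=; apply: eq_bigr => wx _.
  by rewrite inE andbT; case: (wx \in _); case: eqP.
elim: (enum _) => [|wx r IHr]; first by rewrite big_nil.
rewrite big_cons -IHr -pick_jmword /=; case: [pick _ | _] => //=.
Qed.

(** At most [k - nrows s - 1] distinct letters are left.  The second part is about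
    the empty diagram, for which the bound n^(-1) allows no element. *)
Lemma size_remainder s : s \in Ybar k ->
  size (remainder s) <= (#|T| * (k - nrows s).-1) ^ k * n ^ (k - nrows s).-1 /\
  (k - nrows s = 0 -> size (remainder s) = 0).
Proof.
move=> sY.
have le1 : size (remainder s) <= #|remainder_words s|.
  by rewrite size_pmap (leq_trans (count_size _ _)) // cardE.
split; last first.
  move=> e; apply/eqP; rewrite -leqn0; apply: leq_trans le1 _.
  by rewrite leqn0; apply/eqP/eq_card0 => wx; rewrite inE e ltn0 !andbF.
case: (posnP (k - nrows s)) => [e|D0].
  apply: leq_trans le1 _; rewrite (_ : #|_| = 0) //.
  by apply/eq_card0 => wx; rewrite inE e ltn0 !andbF.
have k0 : 0 < k by apply: leq_trans D0 _; exact: leq_subr.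
apply: leq_trans le1 _; rewrite expnMn mulnC mulnA [n ^ _ * _ * _]mulnAC mulnC.
set D := (k - nrows s).-1.
apply: leq_trans (_ : #|setX [set w : {ffun 'I_k -> 'I_n} | #|letters (lword w)| <= D]
                           [set: {ffun 'I_k -> T}]| <= _).
  apply/subset_leq_card/subsetP => wx; rewrite inE => /and3P[_ _ lt].
  by case: wx lt => w x /= lt; rewrite in_setX !inE andbT -ltnS prednK.
rewrite cardsX cardsT card_ffun card_ord mulnC leq_mul2l; apply/orP; right.
by rewrite mulnC; exact: card_few_letters.
Qed.

(** The words are sorted by their shape, and those of the same shape by their
    genus. *)
Lemma nwords_all h :
  nwords y [set: wordT] h =
  \sum_(s <- Ybar k) (nwords y [set wx | wx.1 \in planar_words k n s] h
                      + nwords y (remainder_words s) h).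
Proof.
have uY : uniq (Ybar k) by rewrite filter_uniq // undup_uniq.
rewrite big_seq /= (eq_bigr (fun s =>
  \sum_(wx in [set wx in [set: wordT] | jmword y wx == wincl h]) (wshape wx.1 == s))).
  rewrite -big_seq exchange_big /nwords -sum1_card; apply: eq_bigr => wx.
  rewrite !inE => /eqP e; have pis := jmword_wincl e.
  rewrite -(big_mkcond (fun s => wshape wx.1 == s) (fun=> 1)) /= sum1_count.
  rewrite (eq_count (a2 := pred1 (wshape wx.1))); last by move=> s /=; rewrite eq_sym.
  by rewrite count_uniq_mem // wshape_Ybar.
move=> s sY; rewrite -big_mkcondr /= sum1dep_card.
rewrite -(cardsID [set wx : wordT | #|letters (lword wx.1)| == k - nrows s]); congr (_ + _).
  apply: eq_card => wx; rewrite in_setI !in_set /=.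
  case: (jmword y wx =P wincl h) => [e|_]; last by rewrite ?andbF.
  by rewrite andbT -(planar_words_wshape (jmword_wincl e) sY) in_set.
apply: eq_card => wx; rewrite in_setD !in_set /=.
case: (jmword y wx =P wincl h) => [e|_]; last by rewrite ?andbF.
have pis := jmword_wincl e.
have -> : [exists h0, jmword y wx == wincl h0] by apply/existsP; exists h; rewrite e.
rewrite /= andbT; case: (wshape wx.1 =P s) => [<-|_]; rewrite ?andbF //=.
by rewrite letters_wshape // andbT ltn_neqAle leq_addr andbT.
Qed.

End Remainder.

(** * Coefficients *)

Import GRing.Theory Num.Theory.

Lemma ffact_leq_exp n d : n ^_ d <= n ^ d.
Proof. by elim: d => // d IHd; rewrite ffactnSr expnSr leq_mul // leq_subr. Qed.

Lemma expn_ffact_le n d : n ^ d <= n ^_ d + d ^ 2 * n ^ d.-1.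
Proof.
elim: d => [|d IHd] //; rewrite expnS ffactnSr /=.
have le : n ^_ d * n <= n ^_ d * (n - d) + d * n ^ d.
  rewrite [d * _]mulnC; apply: leq_trans (_ : n ^_ d * (n - d) + n ^_ d * d <= _).
    by rewrite -mulnDr leq_mul2l; apply/orP; right; lia.
  by rewrite leq_add2l leq_mul2r ffact_leq_exp orbT.
have le2 : n * (d ^ 2 * n ^ d.-1) = d ^ 2 * n ^ d.
  case: (d) => [|d'] /=; first by rewrite muln0.
  by rewrite [n ^ d'.+1]expnS mulnCA.
apply: leq_trans (leq_mul (leqnn n) IHd) _; rewrite mulnDr le2 mulnC.
apply: leq_trans (leq_add le (leqnn _)) _; rewrite -addnA leq_add2l -mulnDl.
by rewrite leq_mul2r; apply/orP; right; lia.
Qed.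

Local Open Scope ring_scope.

Section Coefficients.
Variables (K : numFieldType) (T : finGroupType) (n : nat).
Notation star := (@ord_max n).

Lemma gelt_prod (gT : finGroupType) (I : Type) (r : seq I) (F : I -> gT) :
  gelt K (\prod_(i <- r) F i)%g = \prod_(i <- r) gelt K (F i).
Proof. by elim: r => [|i r IHr]; rewrite ?big_nil // !big_cons geltM IHr. Qed.

Lemma jucys_murphy_exp k : jucys_murphy K T n ^+ k =
  \sum_(wx : {ffun 'I_k -> 'I_n} * {ffun 'I_k -> T}) gelt K (wword star (lword wx.1) wx.2).
Proof.
have -> : jucys_murphy K T n = \sum_(ix : 'I_n * T) gelt K (wstep star (lift star ix.1) ix.2).
  by rewrite /jucys_murphy pair_big.
rewrite -[k in LHS]card_ord -prodr_const bigA_distr_bigA /=.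
pose unz (f : {ffun 'I_k -> 'I_n * T}) : {ffun 'I_k -> 'I_n} * {ffun 'I_k -> T} :=
  ([ffun p => (f p).1], [ffun p => (f p).2]).
pose zp (wx : {ffun 'I_k -> 'I_n} * {ffun 'I_k -> T}) : {ffun 'I_k -> 'I_n * T} :=
  [ffun p => (wx.1 p, wx.2 p)].
rewrite (reindex zp) /=.
  apply: eq_bigr => wx _; rewrite -gelt_prod /wword; congr (gelt K _).
  by apply: eq_bigr => p _; rewrite ffunE.
exists unz => [wx|f] _.
  by case: wx => w x; rewrite /unz /zp; congr pair; apply/ffunP => p; rewrite !ffunE.
by apply/ffunP => p; rewrite !ffunE /=; case: (f p).
Qed.

Lemma condexp_word_sum k y h :
  condexp (jucys_murphy K T n ^+ k * gelt K (wat y star)) h =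
  (nwords (n := n) (k := k) y setT h)%:R.
Proof.
rewrite ffunE jucys_murphy_exp mulr_suml.
under eq_bigr => wx _ do rewrite -geltM -/(jmword y wx).
rewrite sum_ffunE /nwords -sum1_card natr_sum [RHS]big_mkcond /=; apply: eq_bigr => wx _.
by rewrite ffunE !inE eq_sym; case: eqP.
Qed.

Lemma class_sumE (rho : {ffun T -> young}) h : class_sum n K rho h = (h \in tclass n rho)%:R.
Proof.
rewrite /class_sum sum_ffunE; case: (boolP (h \in _)) => hc.
  rewrite (bigD1 h) //= ffunE eqxx big1 ?addr0 // => g /andP[_ gh].
  by rewrite ffunE eq_sym (negPf gh).
by rewrite big1 // => g gc; rewrite ffunE; case: eqP => // e; rewrite e gc in hc.
Qed.

Lemma sum_gelt (r : seq (wreath T n)) h : (\sum_(g <- r) gelt K g) h = (count_mem h r)%:R.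
Proof.
rewrite sum_ffunE; elim: r => [|g r IHr]; first by rewrite big_nil.
by rewrite big_cons IHr ffunE /= natrD eq_sym.
Qed.

End Coefficients.

Section MainCoefficient.
Variables (K : numFieldType) (T : finGroupType) (abelT : abelian [set: T]).
Variables (n k : nat) (y : T) (s : young) (f : nfamily T k).
Hypotheses (kn : (k <= n)%N) (sY : s \in Ybar k) (sf : star_cond y s f).

Lemma nrows_le : (nrows s <= k)%N.
Proof. by rewrite -[X in (_ <= X)%N](boxes_strip sY) leq_addl. Qed.

Lemma card_coloured_mult :
  (#|coloured n s f|)%:R = #|NC k s|%:R * (n ^_ (k - nrows s))%:R * #|T|%:R ^+ (k - nrows s)
    * \prod_(j < k) multinomial K (nrow j.+1 (strip s)) (fun x : T => fam_ext s f x j).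
Proof.
have T0 : #|T|%:R != 0 :> K by rewrite pnatr_eq0 -lt0n; apply/card_gt0P; exists 1%g.
have F0 : \prod_(j < k) \prod_a (fam_ext s f a j)`!%:R != 0 :> K.
  by apply/prodf_neq0 => j _; apply/prodf_neq0 => a _; rewrite pnatr_eq0 -lt0n fact_gt0.
have := congr1 (fun m => m%:R : K) (card_coloured abelT n sY sf).
rewrite /multinomial !natrM !natrX !natr_prod.
under eq_bigr => j _ do rewrite natr_prod.
have -> : #|T|%:R ^+ k = #|T|%:R ^+ (k - nrows s) * #|T|%:R ^+ nrows s :> K.
  by rewrite -exprD subnK // nrows_le.
rewrite prodf_div => e.
apply: (mulIf F0); apply: (mulIf (expf_neq0 (nrows s) T0)).
by rewrite mulrAC e -!mulrA mulKf // [X in _ * (_ * (_ * X))]mulrC.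
Qed.

(** The count is constant on the class by conjugation, and zero outside. *)
Lemma nwords_coloured h : (nwords (n := n) y (coloured n s f) h)%:R =
  (#|coloured n s f|%:R / #|famclass n s f|%:R) * (h \in famclass n s f)%:R :> K.
Proof.
case: (boolP (h \in _)) => hc; last first.
  by rewrite mulr0 (nwords_coloured_out abelT kn sY sf hc).
have c0 : #|famclass n s f|%:R != 0 :> K.
  by rewrite pnatr_eq0 -lt0n; apply/card_gt0P; exists h.
rewrite mulr1 -(sum_nwords_coloured abelT kn sY sf).
rewrite (eq_bigr (fun=> nwords y (coloured n s f) h)) => [|g gc].
  by rewrite sum_nat_const natrM mulrC mulKf.
exact: (nwords_coloured_class abelT kn sY sf).
Qed.

End MainCoefficient.

(** * Asymptotics *)

From mathcomp Require Import complex.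
From mathcomp Require Import all_classical all_reals all_analysis.
Import Order.TTheory GRing.Theory Num.Theory.
Import numFieldNormedType.Exports.
Local Open Scope ring_scope.
Local Open Scope classical_set_scope.

(** The factor 1 + O(1/n) of the theorem, for d = k - l(s). *)
Definition falling_ratio (K : fieldType) (d n : nat) : K := (n ^_ d)%:R / n%:R ^+ d.

Lemma falling_ratioK (K : numFieldType) d n : (0 < n)%N ->
  n%:R ^+ d * falling_ratio K d n = (n ^_ d)%:R.
Proof.
by move=> n0; rewrite mulrC divfK // expf_neq0 // pnatr_eq0 -lt0n.
Qed.

Lemma falling_ratio_bound (K : numFieldType) d n : (0 < n)%N ->
  `|falling_ratio K d n - 1| <= (d ^ 2).+1%:R * `|n%:R^-1|.
Proof.
move=> n0; apply: (@le_trans _ _ ((d ^ 2)%:R * `|n%:R^-1|)); last first.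
  by rewrite ler_wpM2r // ler_nat.
have N0 : 0 < n%:R :> K by rewrite ltr0n.
have nd0 : n%:R ^+ d != 0 :> K by rewrite expf_neq0 // gt_eqF.
have -> : falling_ratio K d n - 1 = - ((n ^ d - n ^_ d)%:R / n%:R ^+ d).
  rewrite natrB ?ffact_leq_exp // natrX mulrBl divff //.
  by rewrite opprB.
rewrite normrN ger0_norm ?divr_ge0 ?exprn_ge0 ?ler0n //.
rewrite ger0_norm ?invr_ge0 ?ler0n // ler_pdivrMr ?exprn_gt0 //.
case: d nd0 => [|d] _; first by rewrite ffactn0 expn0 subnn !mul0r.
rewrite exprS mulrA mulfVK ?gt_eqF // -natrX -natrM ler_nat.
by rewrite leq_subLR; exact: expn_ffact_le.
Qed.

Theorem theorem1p2 (R : realType) (T : finGroupType)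
    (abelT : abelian [set: T]%SET) (y : T) (k : nat) :
  exists (c : young -> nfamily T k -> nat -> R[i])
         (N : young -> forall n : nat, seq (wreath T n)),
  [/\
      forall (s : young) (f : nfamily T k), s \in Ybar k -> star_cond y s f ->
        (fun n : nat => c s f n - 1 : R[i]^o)
          =O_\oo (fun n : nat => n%:R^-1 : R[i]^o),
      forall s : young, s \in Ybar k ->
        (fun n : nat => (size (N s n))%:R : R)
          =O_\oo (fun n : nat => n%:R ^ (k%:Z - (nrows s)%:Z - 1) : R),
      \forall n \near \oo, forall s : young, s \in Ybar k ->
        forall g : wreath T n, g \in N s n -> nontriv_type (strip s) g
    & \forall n \near \oo,
        condexp (jucys_murphy R[i] T n ^+ k * gelt R[i] (wat y ord_max)) =
        \sum_(s <- Ybar k)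
          (\sum_(f : nfamily T k | star_cond y s f)
             (#|NC k s|%:R * n%:R ^+ (k - nrows s) * c s f n
              * #|T|%:R ^+ (k - nrows s)
              * \prod_(j < k)
                  multinomial R[i] (nrow j.+1 (strip s))
                    (fun x : T => fam_ext s f x j)
              / #|tclass n (tiota n (boxes (strip s)) (fam_type s f))|%:R)
             *: class_sum n R[i] (tiota n (boxes (strip s)) (fam_type s f))
           + \sum_(g <- N s n) gelt R[i] g)].
Proof.
exists (fun s f n => falling_ratio R[i] (k - nrows s) n), (fun s n => remainder n k y s).
split.
- move=> s f _ _; apply/eqO_exP; exists ((k - nrows s) ^ 2).+1%:R; first by rewrite ltr0n.
  near=> n.
  apply: falling_ratio_bound.
  by near: n; exact: nbhs_infty_gt.
- move=> s sY; apply/eqO_exP.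
  exists ((#|T| * (k - nrows s).-1) ^ k).+1%:R; first by rewrite ltr0n.
  near=> n.
  have [size_le size0] := size_remainder n y sY.
  case: (posnP (k - nrows s)%N) => [/size0 ->|d0]; first by rewrite normr0 mulr_ge0.
  have -> : k%:Z - (nrows s)%:Z - 1 = (k - nrows s).-1%:Z.
    by have := boxes_strip sY; lia.
  rewrite -exprnP -natrX !normr_nat -natrM ler_nat.
  by apply: leq_trans size_le _; rewrite leq_mul2r leqnSn orbT.
- near=> n => s sY g; exact: remainder_nontriv.
near=> n; apply/ffunP => h.
have kn : (k <= n)%N by near: n; exact: nbhs_infty_ge.
have n0 : (0 < n)%N by near: n; exact: nbhs_infty_gt.
rewrite condexp_word_sum nwords_all sum_ffunE natr_sum.
rewrite !big_seq; apply: eq_bigr => s sY.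
rewrite !ffunE sum_gelt natrD count_remainder; congr (_ + _).
rewrite (nwords_planar abelT y h sY) natr_sum sum_ffunE; apply: eq_bigr => f sf.
rewrite (nwords_coloured R[i] abelT kn sY sf) (card_coloured_mult R[i] abelT n sY sf).
by rewrite ffunE class_sumE -[_ * _ * falling_ratio _ _ _]mulrA falling_ratioK.
Unshelve. all: by end_near.
Qed.
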